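(* Let $w$ be a weight function on $[0,1]$ and $W(x,y)=w(\max\{|x|,|y|\})$ on $[-1,1]^2$. In the coordinates $(x,y)=s(\xi,\eta)$ with $s=\max\{|x|,|y|\}$, the system of functions $$\{Q_{k,i}^n:\ i=1,\dots,\min\{n-k+1,4\},\ 0\le k\le n,\ n\ge0\},\qquad Q_{k,i}^n(x,y)=P_{k,2n-2k}(s)\,s^{n-k}\,Y_{n-k,i}\!\left(\frac xs,\frac ys\right),$$ is a complete orthogonal basis for $L^2(W;[-1,1]^2)$.
   Context: A weight function on $[0,1]$ is a nonnegative measurable function with all moments finite and with positive integral. $L^2(W;[-1,1]^2)$ carries the inner product $\langle f,g\rangle_W=\int_{-1}^1\int_{-1}^1f(x,y)g(x,y)W(x,y)\,dx\,dy$. For $(x,y)\neq0$, $(\xi,\eta)=(x/s,y/s)$ lies on the boundary of $[-1,1]^2$. For $0\le k\le n$, $P_{m,2n-2k}$ denotes an orthogonal polynomial of degree exactly $m$ with respect to the weight $t^{2n-2k+1}w(t)$ on $[0,1]$, with $P_{0,2n-2k}:=1$. Let $$\langle f,g\rangle=\int_{-1}^1[f(\xi,1)g(\xi,1)+f(\xi,-1)g(\xi,-1)]\,d\xi+\int_{-1}^1[f(1,\eta)g(1,\eta)+f(-1,\eta)g(-1,\eta)]\,d\eta,$$ an inner product on $\mathbb R[x,y]/I$, $I=\langle(1-x^2)(1-y^2)\rangle$, and let $\mathcal{BV}_n^2$ be the space of classes modulo $I$ of polynomials of total degree at most $n$ orthogonal to all polynomials of total degree at most $n-1$; its dimension is $\min\{n+1,4\}$.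 $\{Y_{n,i}:1\le i\le\min\{n+1,4\}\}$ is a mutually orthogonal basis of $\mathcal{BV}_n^2$. *)

(* Defs.v *)
From HB Require Import structures.
From mathcomp Require Import all_boot all_order all_algebra.
From mathcomp Require Import all_classical all_reals all_analysis.
(* The notations of mpoly clash with those of mathcomp-analysis. *)
From mathcomp Require Import -(notations) mpoly.

Set Implicit Arguments.
Unset Strict Implicit.
Unset Printing Implicit Defensive.

Import Order.TTheory GRing.Theory Num.Theory.
Import numFieldNormedType.Exports.

Local Open Scope classical_set_scope.
Local Open Scope ring_scope.

Section OneVariable.
Context {R : realType}.
Implicit Types (w v : R -> R) (p q : {poly R}).

Definition weight_function w : Prop :=
  [/\ measurable_fun `[0 : R, 1] w,
      forall t, t \in `[0 : R, 1] -> 0 <= w t,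
      forall j : nat,
        (@lebesgue_measure R).-integrable `[0 : R, 1]
          (fun t => (t ^+ j * w t)%:E)
    & 0 < \int[@lebesgue_measure R]_(t in `[0 : R, 1]) w t].

Definition orthogonal_poly v (m : nat) p : Prop :=
  size p = m.+1 /\
  forall q, (size q <= m)%N ->
    \int[@lebesgue_measure R]_(t in `[0 : R, 1]) (p.[t] * q.[t] * v t) = 0.

End OneVariable.

Section WeightedL2.
Context {R : realType}.
Implicit Types (W f g : R * R -> R).

Definition square : set (R * R) := `[-1 : R, 1] `*` `[-1 : R, 1].

Definition lebesgue2 :=
  (@lebesgue_measure R \x @lebesgue_measure R)%E.

(* Elements of L^2(W) are represented by functions; the W-a.e. equality of the
   L^2 space is the relation [normW W (f - g) = 0]. *)
Definition L2W W f : Prop :=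
  measurable_fun square f /\
  lebesgue2.-integrable square (fun z => (f z ^+ 2 * W z)%:E).

Definition innerW W f g : R :=
  \int[lebesgue2]_(z in square) (f z * g z * W z).

Definition normW W f : R := Num.sqrt (innerW W f f).

(* Complete: finite linear combinations are dense in L^2(W).
   [0 < normW W (e a)] says that [e a] is not the zero class. *)
Definition complete_orthogonal_basis W (I : eqType) (e : I -> R * R -> R) : Prop :=
  [/\ forall a, L2W W (e a) /\ 0 < normW W (e a),
      forall a b, a != b -> innerW W (e a) (e b) = 0
    & forall f, L2W W f -> forall eps : R, 0 < eps ->
        exists (s : seq I) (c : I -> R),
          normW W (fun z => f z - \sum_(a <- s) c a * e a z) < eps].

End WeightedL2.

Section BoundaryOfSquare.
Context {R : realType}.
Local Notation poly2 := (mpoly 2 R).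
Implicit Types (p q r : poly2) (n : nat).

Definition eval2 p (x y : R) : R :=
  meval (fun i : 'I_2 => if i == ord0 then x else y) p.

(* The generator (1 - x^2)(1 - y^2) of the ideal I. *)
Definition bgen : poly2 :=
  (1 - mpolyX R (mnm1 ord0) ^+ 2) *
  (1 - mpolyX R (mnm1 ord_max) ^+ 2).

(* Elements of R[x,y]/I are represented by polynomials; [eqI] is equality in
   the quotient. Both [eval2] at a boundary point of the square and [innerB]
   only depend on the classes. *)
Definition eqI p q : Prop := exists r, p - q = r * bgen.

Definition innerB p q : R :=
  (\int[@lebesgue_measure R]_(xi in `[-1 : R, 1])
     (eval2 p xi 1 * eval2 q xi 1 + eval2 p xi (-1) * eval2 q xi (-1)))
  + (\int[@lebesgue_measure R]_(eta in `[-1 : R, 1])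
     (eval2 p 1 eta * eval2 q 1 eta + eval2 p (-1) eta * eval2 q (-1) eta)).

(* [msize] is the total degree plus one (and 0 for the zero polynomial), so
   [msize r <= n] is "degree at most n - 1", also when n = 0. *)
Definition BV n p : Prop :=
  exists q, [/\ eqI p q, (msize q <= n.+1)%N
    & forall r, (msize r <= n)%N -> innerB q r = 0].

Definition orthogonal_basis_BV n (J : finType) (Y : J -> poly2) : Prop :=
  [/\ forall i, BV n (Y i),
      forall c : J -> R, eqI (\sum_i c i *: Y i) 0 -> forall i, c i = 0,
      forall p, BV n p -> exists c : J -> R, eqI p (\sum_i c i *: Y i)
    & forall i j, i != j -> innerB (Y i) (Y j) = 0].

End BoundaryOfSquare.

Section TheSystem.
Context {R : realType}.

Definition maxnorm (z : R * R) : R := Num.max `|z.1| `|z.2|.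

(* The triples (n, k, i) with 0 <= k <= n and i among min(n - k + 1, 4)
   indices, numbered from 0. *)
Definition Qindex : eqType :=
  {n : nat & {k : 'I_n.+1 & 'I_(minn (n - k).+1 4)}}.

(* At the origin s = 0 and z.1 / s = z.2 / s = 0; that point is a null set. *)
Definition Q (P : nat -> nat -> {poly R})
    (Y : forall m : nat, 'I_(minn m.+1 4) -> mpoly 2 R)
    (a : Qindex) (z : R * R) : R :=
  let n := tag a in
  let k := tag (tagged a) in
  let i := tagged (tagged a) in
  let s := maxnorm z in
  (P k (2 * n - 2 * k)%N).[s] * s ^+ (n - k)
    * eval2 (Y (n - k)%N i) (z.1 / s) (z.2 / s).

End TheSystem.

(* Main.v *)
Require Import Defs.
From HB Require Import structures.
From mathcomp Require Import all_boot all_order all_algebra.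
From mathcomp Require Import all_classical all_reals all_analysis.
From mathcomp Require Import measurable_realfun.
From mathcomp Require Import -(notations) mpoly.
From mathcomp Require Import ring lra zify.

Set Implicit Arguments.
Unset Strict Implicit.
Unset Printing Implicit Defensive.

Import Order.TTheory GRing.Theory Num.Theory.
Import numFieldNormedType.Exports.

Local Open Scope classical_set_scope.
Local Open Scope ring_scope.

(** A point of the square other than the origin is s times a boundary point,
    with s = max(|x|, |y|), and in these coordinates dx dy is s ds times the
    length element of the boundary ([ge0_integral_polar]).  Hence a function
    A(s) p(x/s, y/s) w(s) integrates to the product of the integral of
    t A(t) w(t) over [0, 1] and the boundary integral of p
    ([polar_factors_ge0], [polar_factorsP]).  The inner product of two members
    of the system is thus a radial integral times an inner product of two
    Y's on the boundary.

    Orthogonality: when the values of n - k or of i differ, the boundary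
    factor vanishes; otherwise the values of k differ, and since the powers of
    s and the Jacobian multiply to t^(2(n-k)+1), the radial factor vanishes by
    the orthogonality of the P's ([innerW_Q_eq0]).  The norms are positive:
    a nonzero polynomial has finitely many roots ([intpoly_gt0]), and a
    polynomial vanishing on the four sides lies in the ideal I
    ([vanish_boundary_eqI]), so a member of a basis modulo I has a positive
    boundary norm.

    Completeness has an algebraic and an analytic half.  For fixed j = n - k
    the P_(k,2j) have every degree, so the span contains
    A(s) s^j Y_(j,i)(x/s, y/s) for every polynomial A.  The Gram-Schmidt process
    on the boundary expands every polynomial of degree at most m into the
    Y_(j,i) with j <= m ([boundary_span]).  A monomial of degree m is s^m times
    its value at the boundary point, hence belongs to the span almost
    everywhere ([spanned_poly]).  The polynomials are dense ([poly_dense]):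
    (1 - t^n)^(2^n) tends boundedly on [0, 1] to the indicator of t < 1/2
    except at t = 1/2 ([cvg_threshold]), so that the closed span contains the
    indicators of quadrants, hence of all Borel sets by Dynkin's pi-lambda
    theorem ([spanned_dynkin]), hence all simple functions and all of L2
    ([spanned_all]). *)

(** * Polynomials in one variable *)

Section PolynomialSpan.
Context {R : realType}.

Lemma poly_eq0_itv (q : {poly R}) :
  (forall t : R, -1 < t < 1 -> q.[t] = 0) -> q = 0.
Proof.
move=> q0; apply/eqP/negP => /negP qn0.
pose s := [seq (k.+2%:R)^-1 : R | k <- iota 0 (size q)].
have /(max_poly_roots qn0) : all (root q) s.
  apply/allP => _ /mapP[k _ ->]; apply/eqP/q0.
  rewrite invf_lt1 ?ltr0n// ltr1n andbT (lt_trans (ltrN10 R))//.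
move=> h; suff /h : uniq s by rewrite size_map size_iota ltnn.
rewrite map_inj_uniq ?iota_uniq// => i j /invr_inj/eqP.
by rewrite eqr_nat => /eqP[].
Qed.

(** A linear span is encoded as the intersection of the predicates [K] that
    contain the generators and are closed under linear combinations: no
    coefficient has to be named.  Subtracting a multiple of the generator of
    the same degree lowers the degree. *)
Lemma poly_span (K : {poly R} -> Prop) (u : nat -> {poly R}) :
  K 0 -> (forall c p q, K p -> K q -> K (c *: p + q)) ->
  (forall k, size (u k) = k.+1 /\ K (u k)) -> forall p, K p.
Proof.
move=> K0 KD Ku p; have [n] := ubnP (size p); elim: n p => // n IH p.
have [->//|p0] := eqVneq p 0; rewrite ltnS => pn.
have sp : (0 < size p)%N by rewrite lt0n size_poly_eq0.
set k := (size p).-1; have [su uK] := Ku k.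
pose c := lead_coef p / lead_coef (u k).
have lu : lead_coef (u k) != 0 by rewrite lead_coef_eq0 -size_poly_eq0 su.
rewrite -(subrK (c *: u k) p) addrC; apply: KD => //; apply: IH.
apply: leq_trans pn; rewrite -(prednK sp) -/k ltnS.
apply/leq_sizeP => i ki; rewrite coefB coefZ.
have [ik|ik] := eqVneq i k.
  rewrite ik /c !lead_coefE su /= -/k divfK ?subrr//.
  by move: lu; rewrite lead_coefE su.
have {ik}ki : (k < i)%N by rewrite ltn_neqAle eq_sym ik.
rewrite !nth_default ?mulr0 ?subr0// ?su//.
by rewrite -(prednK sp) -/k.
Qed.

End PolynomialSpan.

(** * Polynomials vanishing on the boundary of the square *)

Section VanishingIdeal.
Context {R : realType}.
Local Notation poly2 := (mpoly 2 R).
Implicit Types (p q r : poly2) (i : 'I_2).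

(** The restriction of [p] to the line where variable [i] equals [c], as a
    polynomial in the other variable. *)
Definition restr i (c : R) p : {poly R} :=
  mmap polyC (fun j => if j == i then c%:P else 'X) p.

Lemma ord2_eq1 i : i != ord0 -> i = ord_max.
Proof. by move=> i0; apply/val_inj; case: i i0 => -[|[|]]. Qed.

Lemma horner_mmap (h : 'I_2 -> {poly R}) p t :
  (mmap polyC h p).[t] = meval (fun i => (h i).[t]) p.
Proof.
rewrite /meval /mmap horner_sum; apply: eq_bigr => m _.
rewrite hornerM hornerC /mmap1 horner_prod; congr *%R.
by apply: eq_bigr => i _; rewrite horner_exp.
Qed.

Lemma restr0E c p t : (restr ord0 c p).[t] = eval2 p c t.
Proof.
rewrite /restr horner_mmap; apply: meval_eq => i.
by case: ifP; rewrite ?hornerC ?hornerX.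
Qed.

Lemma restr1E c p t : (restr ord_max c p).[t] = eval2 p t c.
Proof.
rewrite /restr horner_mmap; apply: meval_eq => i.
have [->|/ord2_eq1 ->] := eqVneq i ord0; first by rewrite /= hornerX.
by rewrite eqxx hornerC.
Qed.

Definition other i : 'I_2 := if i == ord0 then ord_max else ord0.

(** A polynomial in one variable, read as a polynomial in the variable that is
    not [i]. *)
Definition lift_other i (q : {poly R}) : poly2 :=
  (map_poly (@mpolyC 2 R) q).[mpolyX R (mnm1 (other i))].

Lemma neq_other i j : j != i -> j = other i.
Proof.
rewrite /other; have [->/ord2_eq1//|/ord2_eq1 ->] := eqVneq i ord0.
by have [//|/ord2_eq1 ->] := eqVneq j ord0; rewrite eqxx.
Qed.

Lemma restrM i c : {morph restr i c : p q / p * q}.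
Proof. by move=> p q; rewrite /restr rmorphM. Qed.

Lemma restrD i c : {morph restr i c : p q / p + q}.
Proof. by move=> p q; rewrite /restr mmapD. Qed.

Lemma restrZ i c a p : restr i c (a *: p) = a *: restr i c p.
Proof. by rewrite /restr mmapZ mul_polyC. Qed.

Lemma lift_otherM i : {morph lift_other i : p q / p * q}.
Proof. by move=> p q; rewrite /lift_other rmorphM/= hornerM. Qed.

Lemma lift_otherD i : {morph lift_other i : p q / p + q}.
Proof. by move=> p q; rewrite /lift_other rmorphD/= hornerD. Qed.

Lemma lift_otherC i a : lift_other i a%:P = mpolyC 2 a.
Proof. by rewrite /lift_other map_polyC/= hornerC. Qed.

Lemma lift_otherX i : lift_other i 'X = mpolyX R (mnm1 (other i)).
Proof. by rewrite /lift_other map_polyX hornerX. Qed.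

(** Both sides of the difference are ring morphisms in [p] that agree on the
    other variable and on constants, and differ on variable [i] by the divisor
    itself; divisibility of the difference passes to products and sums. *)
Lemma dvd_sub_restr i c p :
  exists r, p - lift_other i (restr i c p) = r * (mpolyX R (mnm1 i) - mpolyC 2 c).
Proof.
set d := _ - mpolyC 2 c.
have dM p1 p2 :
    (exists r, p1 - lift_other i (restr i c p1) = r * d) ->
    (exists r, p2 - lift_other i (restr i c p2) = r * d) ->
    exists r, p1 * p2 - lift_other i (restr i c (p1 * p2)) = r * d.
  move=> [r1 e1] [r2 e2]; exists (p1 * r2 + r1 * lift_other i (restr i c p2)).
  rewrite restrM lift_otherM mulrDl -mulrA -e2 -mulrA [_ * d]mulrC mulrA -e1; ring.
have dC a : exists r, mpolyC 2 a - lift_other i (restr i c (mpolyC 2 a)) = r * d.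
  by exists 0; rewrite /restr mmapC lift_otherC subrr mul0r.
have dX j : exists r, mpolyX R (mnm1 j) -
    lift_other i (restr i c (mpolyX R (mnm1 j))) = r * d.
  rewrite /restr mmapX mmap1U.
  have [->|/neq_other ->] := eqVneq j i.
    by exists 1; rewrite lift_otherC mul1r.
  by exists 0; rewrite lift_otherX subrr mul0r.
elim/mpolyind: p => [|a m p _ _ [r e]].
  by rewrite -(mpolyC0 2 R); exact: dC.
have [r' e'] : exists r, a *: mpolyX R m -
    lift_other i (restr i c (a *: mpolyX R m)) = r * d.
  rewrite -mul_mpolyC; apply: (dM _ _ (dC a)).
  rewrite mpolyXE_id; elim/big_ind: _ => [|//|j _].
    by rewrite -(mpolyC1 2 R); exact: dC.
  elim: (m j) => [|k IH]; first by rewrite expr0 -(mpolyC1 2 R); exact: dC.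
  by rewrite exprS; exact: dM.
by exists (r' + r); rewrite restrD lift_otherD mulrDl -e -e'; ring.
Qed.

Lemma restr_eq0_dvd i c p : (forall t : R, -1 < t < 1 -> (restr i c p).[t] = 0) ->
  exists r, p = r * (mpolyX R (mnm1 i) - mpolyC 2 c).
Proof.
move=> p0; have [r e] := dvd_sub_restr i c p; exists r.
by rewrite -e (poly_eq0_itv p0) /lift_other rmorph0 horner0 subr0.
Qed.

Lemma eval2M p q x y : eval2 (p * q) x y = eval2 p x y * eval2 q x y.
Proof. exact: mevalM. Qed.

Lemma eval2D p q x y : eval2 (p + q) x y = eval2 p x y + eval2 q x y.
Proof. exact: mevalD. Qed.

Lemma eval2B p q x y : eval2 (p - q) x y = eval2 p x y - eval2 q x y.
Proof. exact: mevalB. Qed.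

Lemma eval2Z a p x y : eval2 (a *: p) x y = a * eval2 p x y.
Proof. exact: mevalZ. Qed.

Lemma eval2C (c x y : R) : eval2 (mpolyC 2 c) x y = c.
Proof. exact: mevalC. Qed.

Lemma eval2X0 (x y : R) : eval2 (mpolyX R (mnm1 ord0)) x y = x.
Proof. by rewrite /eval2 mevalXU. Qed.

Lemma eval2X1 (x y : R) : eval2 (mpolyX R (mnm1 ord_max)) x y = y.
Proof. by rewrite /eval2 mevalXU. Qed.

Lemma eval2_bgen (x y : R) : eval2 bgen x y = (1 - x ^+ 2) * (1 - y ^+ 2).
Proof.
by rewrite /bgen -(mpolyC1 2 R) eval2M !eval2B !expr2 !eval2M eval2X0 eval2X1 eval2C.
Qed.

Definition onboundary (x y : R) := Num.max `|x| `|y| = 1.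

Definition eq_boundary p q := forall x y, onboundary x y -> eval2 p x y = eval2 q x y.

Lemma onboundaryP x y : onboundary x y ->
  (x = 1 \/ x = -1) \/ (y = 1 \/ y = -1).
Proof.
rewrite /onboundary maxEle; case: ifP => _ /eqP; rewrite eqr_norml => /andP[];
  by move=> /orP[]/eqP; auto.
Qed.

Lemma eqI_eq_boundary p q : eqI p q -> eq_boundary p q.
Proof.
move=> [r pq] x y /onboundaryP xy; apply/eqP; rewrite -subr_eq0 -eval2B pq.
rewrite eval2M eval2_bgen.
by case: xy => -[] ->; apply/eqP; ring.
Qed.

Lemma onboundary1y (y : R) : -1 <= y <= 1 -> onboundary 1 y.
Proof. by move=> y1; rewrite /onboundary normr1 max_l// ler_norml. Qed.

Lemma onboundaryN (x y : R) : onboundary x y -> onboundary (- x) y.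
Proof. by rewrite /onboundary normrN. Qed.

Lemma onboundaryC (x y : R) : onboundary x y -> onboundary y x.
Proof. by rewrite /onboundary maxC. Qed.

(** The four linear factors are split off one side after the other.  On a
    later side the factors already found may vanish, but only at the corners;
    hence the open interval in [restr_eq0_dvd]. *)
Lemma vanish_boundary_eqI p : (forall x y, onboundary x y -> eval2 p x y = 0) ->
  eqI p 0.
Proof.
move=> p0.
have w (t : R) : -1 < t < 1 -> -1 <= t <= 1.
  by move=> /andP[a b]; rewrite !ltW.
have [|r1 e1] := @restr_eq0_dvd ord0 1 p.
  by move=> t /w t1; rewrite restr0E; exact/p0/onboundary1y.
have [|r2 e2] := @restr_eq0_dvd ord0 (-1) r1.
  move=> t /w t1; rewrite restr0E.
  have /eqP := p0 (-1) t (onboundaryN (onboundary1y t1)).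
  rewrite e1 eval2M eval2B eval2X0 eval2C mulf_eq0 => /orP[/eqP//|].
  by move=> /eqP h; exfalso; move: h; clear; lra.
(* For -1 < t < 1 the factors t - 1 and t + 1 are nonzero at (t, 1). *)
have [|r3 e3] := @restr_eq0_dvd ord_max 1 r2.
  move=> t tt; have /w t1 := tt; rewrite restr1E.
  have /eqP := p0 t 1 (onboundaryC (onboundary1y t1)).
  rewrite e1 e2 !eval2M !eval2B !eval2X0 !eval2C !mulf_eq0 -orbA.
  move=> /or3P[/eqP//| |] /eqP h; exfalso; move: tt h; clear; lra.
have [|r4 e4] := @restr_eq0_dvd ord_max (-1) r3.
  move=> t tt; have /w t1 := tt; rewrite restr1E.
  have /eqP := p0 t (-1) (onboundaryC (onboundaryN (onboundary1y t1))).
  rewrite e1 e2 e3 !eval2M !eval2B eval2X1 !eval2X0 !eval2C !mulf_eq0 -!orbA.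
  move=> /or4P[/eqP//| | |] /eqP h; exfalso; move: tt h; clear; lra.
exists r4; rewrite e1 e2 e3 e4 /bgen !rmorphN !rmorph1; ring.
Qed.

End VanishingIdeal.

(** * Integrals of polynomials against a weight *)

Section Moments.
Context {R : realType} (D : set R) (v : R -> R).
Local Notation mu := (@lebesgue_measure R).
Hypothesis mD : measurable D.
Hypothesis mom : forall j : nat, mu.-integrable D (fun t => (t ^+ j * v t)%:E).
Implicit Types p q : {poly R}.

Definition intpoly q : R := \int[mu]_(t in D) (q.[t] * v t).

Lemma integrable_poly q : mu.-integrable D (fun t => (q.[t] * v t)%:E).
Proof.
have -> : (fun t => (q.[t] * v t)%:E) =
    (fun t => \sum_(i < size q) (q`_i)%:E * (t ^+ i * v t)%:E)%E.
  apply/funext => t; rewrite horner_coef mulr_suml -sumEFin.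
  by apply: eq_bigr => i _; rewrite -EFinM mulrA.
by apply: integrable_sum => // i _; exact: integrableZl.
Qed.

Lemma intpolyD p q : intpoly (p + q) = intpoly p + intpoly q.
Proof.
rewrite /intpoly -RintegralD//; [|exact: integrable_poly..].
by apply: eq_Rintegral => t _; rewrite hornerD mulrDl.
Qed.

Lemma intpolyZ c q : intpoly (c *: q) = c * intpoly q.
Proof.
rewrite /intpoly -RintegralZl//; last exact: integrable_poly.
by apply: eq_Rintegral => t _; rewrite hornerZ mulrA.
Qed.

Lemma intpoly_ge0 q : (forall t, D t -> 0 <= v t) ->
  (forall t, D t -> 0 <= q.[t]) -> 0 <= intpoly q.
Proof.
by move=> v0 q0; apply: Rintegral_ge0 => t Dt; rewrite mulr_ge0 ?v0 ?q0.
Qed.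

(** If the integral were zero, [q * v] would vanish almost everywhere, and so
    would [v], because [q] has finitely many roots. *)
Lemma intpoly_gt0 q : (forall t, D t -> 0 <= v t) ->
  0 < \int[mu]_(t in D) v t -> q != 0 ->
  (forall t, D t -> 0 <= q.[t]) -> 0 < intpoly q.
Proof.
move=> v0 iv qn0 q0; rewrite lt_def intpoly_ge0// andbT; apply/negP => /eqP iq.
have mv : measurable_fun D v.
  have := measurable_int _ (mom 0).
  by move/measurable_EFinP; under eq_fun do rewrite expr0 mul1r.
have mqv : measurable_fun D (fun t => (q.[t] * v t)%:E).
  exact: measurable_int (integrable_poly q).
have qv0 : (\int[mu]_(t in D) `|(q.[t] * v t)%:E|)%E = 0%E.
  transitivity (\int[mu]_(t in D) (q.[t] * v t)%:E)%E.
    by apply: eq_integral => t /[!inE] Dt; rewrite gee0_abs// lee_fin mulr_ge0 ?v0 ?q0.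
  rewrite -[LHS]fineK; last exact/integrable_fin_num/integrable_poly.
  by congr EFin.
have [N [mN N0 DN]] := (ae_eq_integral_abs mu mD mqv).1 qv0.
pose Z := [set t | root q t].
have fZ : finite_set Z.
  apply: contrapT => /(infinite_set_fset (size q))[B BZ].
  rewrite leqNgt => /negP; apply; apply: max_poly_roots => //.
    by apply/allP => t tB; exact: BZ.
  exact: finmap.fset_uniq.
have mZ : measurable Z.
  by apply: countable_measurable => //; exact: finite_set_countable.
suff : \int[mu]_(t in D) v t = 0 by move=> e; rewrite e ltxx in iv.
rewrite /Rintegral (@ge0_ae_eq_integral _ _ _ mu D _ (cst 0%E)) ?integral0//.
  exact/measurable_EFinP.
exists (N `|` Z); split; first exact: measurableU.
  rewrite null_set_setU//; apply: countable_lebesgue_measure0.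
  exact: finite_set_countable.
move=> t /=; have [Zt|nZ] := pselect (Z t); first by right.
move=> h; left; apply: DN => /= g; apply: h => Dt; move: (g Dt) => /=.
move=> [] /eqP; rewrite mulf_eq0 => /orP[/eqP rt|/eqP ->//].
by exfalso; apply: nZ; apply/eqP.
Qed.

End Moments.

(** * The inner product on the boundary *)

Section BoundaryInner.
Context {R : realType}.
Local Notation poly2 := (mpoly 2 R).
Local Notation mu := (@lebesgue_measure R).
Implicit Types (p q r : poly2).

(** All four sides are parametrized by [-1, 1], so that the boundary integral
    becomes the integral of a single polynomial. *)
Definition boundary_poly p : {poly R} :=
  (restr ord_max 1 p + restr ord_max (-1) p)
  + (restr ord0 1 p + restr ord0 (-1) p).

Definition boundary_int p : R := intpoly `[-1 : R, 1] (cst 1) (boundary_poly p).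

Lemma moments1 (a b : R) (j : nat) :
  mu.-integrable `[a, b] (fun t => (t ^+ j * cst 1 t)%:E).
Proof.
apply: continuous_compact_integrable; first exact: segment_compact.
apply: continuous_subspaceT => t.
by apply: cvgM; [exact: exprn_continuous|exact: cvg_cst].
Qed.

Lemma innerBE p q : innerB p q = boundary_int (p * q).
Proof.
rewrite /innerB /boundary_int /boundary_poly intpolyD//; last by move=> j; exact: moments1.
by congr (_ + _); apply: eq_Rintegral => t _;
  rewrite hornerD ?restr0E ?restr1E !eval2M mulr1.
Qed.

Lemma innerBC p q : innerB p q = innerB q p.
Proof. by rewrite !innerBE mulrC. Qed.

Lemma innerB_linear r c p q : innerB (c *: p + q) r = c * innerB p r + innerB q r.
Proof.
rewrite !innerBE /boundary_int -intpolyZ//; last by move=> j; exact: moments1.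
rewrite -intpolyD//; last by move=> j; exact: moments1.
congr intpoly; rewrite mulrDl -scalerAl /boundary_poly !restrD !restrZ !scalerDr.
by rewrite -!mul_polyC; ring.
Qed.

Lemma innerB0 r : innerB 0 r = 0.
Proof. by have := innerB_linear r (-1) 0 0; rewrite scaler0 addr0 mulN1r addNr. Qed.

Lemma innerBB r p q : innerB (p - q) r = innerB p r - innerB q r.
Proof. by rewrite addrC -scaleN1r innerB_linear mulN1r addrC. Qed.

Lemma innerB_sum (J : Type) (s : seq J) (F : J -> poly2) r :
  innerB (\sum_(j <- s) F j) r = \sum_(j <- s) innerB (F j) r.
Proof.
elim/big_rec2: _ => [|j y1 y2 _ <-]; first by rewrite innerB0.
by rewrite -[F j]scale1r innerB_linear scale1r mul1r.
Qed.

Lemma eq_boundary_innerB p q r : eq_boundary p q -> innerB p r = innerB q r.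
Proof.
move=> pq; rewrite /innerB.
by congr (_ + _); apply: eq_Rintegral => t; rewrite inE/= in_itv/= => t1;
  rewrite !pq//; do ?[apply: onboundaryN]; do ?[exact: onboundary1y];
  apply: onboundaryC; do ?[apply: onboundaryN]; exact: onboundary1y.
Qed.

(** The integrand is the polynomial [boundary_poly (p * p)], a sum of the squares
    of the four restrictions; if it is the zero polynomial, then [p] vanishes
    on the boundary. *)
Lemma innerB_gt0 p : ~ eqI p 0 -> 0 < innerB p p.
Proof.
move=> pn0; have bdE t : (boundary_poly (p * p)).[t] =
  (eval2 p t 1) ^+ 2 + (eval2 p t (-1)) ^+ 2
  + ((eval2 p 1 t) ^+ 2 + (eval2 p (-1) t) ^+ 2).
  by rewrite /boundary_poly !hornerD !restr0E !restr1E !eval2M !expr2.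
rewrite innerBE; apply: intpoly_gt0 => //.
- exact: moments1.
- rewrite Rintegral_cst//= lebesgue_measure_itv/= lte_fin.
  by rewrite ifT ?mul1r /=; lra.
- apply/eqP => b0; apply: pn0; apply: vanish_boundary_eqI => x y /onboundaryP xy.
  have s0 (t : R) := bdE t; rewrite b0 in s0.
  have {}s0 (t : R) : 
      [/\ eval2 p t 1 = 0, eval2 p t (-1) = 0, eval2 p 1 t = 0 & eval2 p (-1) t = 0].
    move: (s0 t); rewrite horner0 => /esym/eqP.
    rewrite !paddr_eq0 ?addr_ge0 ?sqr_ge0// !sqrf_eq0.
    by move=> /andP[/andP[/eqP ? /eqP ?] /andP[/eqP ? /eqP ?]].
  by case: xy => -[] ->; [case: (s0 y)|case: (s0 y)|case: (s0 x)|case: (s0 x)].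
- by move=> t _; rewrite bdE !addr_ge0 ?sqr_ge0.
Qed.

End BoundaryInner.

(** * Expansion of polynomials on the boundary *)

Section BoundarySpan.
Context {R : realType}.
Local Notation poly2 := (mpoly 2 R).
Variable Y : forall m : nat, 'I_(minn m.+1 4) -> poly2.
Hypothesis hY : forall m : nat, orthogonal_basis_BV m (@Y m).

(** A basis element that is null on the boundary would contradict freeness modulo
    the ideal. *)
Lemma innerY_gt0 m i : 0 < innerB (@Y m i) (@Y m i).
Proof.
apply: innerB_gt0 => Y0; have [_ free _ _] := hY m.
have /(_ _ i)/eqP := free (fun j => (j == i)%:R).
rewrite eqxx oner_eq0 => /(_ _)/negP; apply => //.
rewrite (bigD1 i)//= eqxx scale1r big1 ?addr0//.
by move=> j /negPf ->; rewrite scale0r.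
Qed.

(** Only the classes of the Y's have degrees [m] and [j], so both are replaced by
    representatives of those degrees. *)
Lemma innerY_lt m j k i : (j < m)%N -> innerB (@Y m i) (@Y j k) = 0.
Proof.
move=> jm; have [+ _ _ _] := hY m => /(_ i)[q [/eqI_eq_boundary eq _ oq]].
have [+ _ _ _] := hY j => /(_ k)[r [/eqI_eq_boundary er sr _]].
rewrite (eq_boundary_innerB _ eq) innerBC (eq_boundary_innerB _ er) innerBC.
by apply: oq; exact: leq_trans sr jm.
Qed.

Lemma innerY_neq m j i k : m != j -> innerB (@Y m i) (@Y j k) = 0.
Proof.
by rewrite neq_ltn => /orP[mj|jm]; [rewrite innerBC|]; exact: innerY_lt.
Qed.

(** Gram-Schmidt, one degree at a time: a polynomial minus its projection onto
    the Y's of lower degree is orthogonal to all polynomials of lower degree, so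
    it is a combination of the Y's of its own degree; the projection itself has
    lower degree, and the induction hypothesis applies to it. *)
Lemma boundary_span (K : poly2 -> Prop) m :
  K 0 -> (forall c p q, K p -> K q -> K (c *: p + q)) ->
  (forall p q, eq_boundary p q -> K p -> K q) ->
  (forall j i, (j < m)%N -> K (@Y j i)) ->
  forall p, (msize p <= m)%N -> K p.
Proof.
elim: m K => [|m IH] K K0 KD Keq KY p.
  by rewrite leqn0 msize_poly_eq0 => /eqP ->.
move=> pm; pose q j i := sval (cid ((let: And4 h _ _ _ := hY j in h) i)).
have qP j i : [/\ eqI (@Y j i) (q j i), (msize (q j i) <= j.+1)%N &
    forall r, (msize r <= j)%N -> innerB (q j i) r = 0].
  by rewrite /q; case: cid.
pose r := \sum_(j < m) \sum_i
  (innerB p (@Y j i) / innerB (@Y j i) (@Y j i)) *: q j i.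
have rm : (msize r <= m)%N.
  apply: leq_trans (msize_sum _ _ _) _; apply/bigmax_leqP => j _.
  apply: leq_trans (msize_sum _ _ _) _; apply/bigmax_leqP => i _.
  apply: leq_trans (msizeZ_le _ _) _; have [_ + _] := qP j i.
  by move/leq_trans; apply.
have qY j i s : innerB (q j i) s = innerB (@Y j i) s.
  by apply/esym/eq_boundary_innerB/eqI_eq_boundary; case: (qP j i).
(* The residual is its own representative of degree m; orthogonality to a
   polynomial s of smaller degree is the induction hypothesis for the
   predicate that s be orthogonal to the residual. *)
have [_ _ span _] := hY m.
have [|c pr] := span (p - r).
  exists (p - r); split.
  - by exists 0; rewrite subrr mul0r.
  - by rewrite (leq_trans (msizeD_le _ _))// geq_max pm msizeN leqW.
  move=> s sm; rewrite innerBC.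
  apply: (IH (fun s => innerB s (p - r) = 0)) sm.
  - exact: innerB0.
  - by move=> a u v u0 v0; rewrite innerB_linear u0 v0 mulr0 addr0.
  - by move=> u v uv; rewrite (eq_boundary_innerB _ uv).
  move=> j i jm; rewrite innerBC innerBB; apply/eqP; rewrite subr_eq0; apply/eqP.
  rewrite /r innerB_sum (bigD1 (Ordinal jm))//= [X in _ + X]big1 ?addr0; last first.
    move=> l lj; rewrite innerB_sum big1// => k _.
    rewrite -[_ *: _]addr0 innerB_linear innerB0 qY (@innerY_neq l j k i) ?mulr0 ?addr0//.
  rewrite innerB_sum (bigD1 i)//= [X in _ + X]big1 ?addr0.
    rewrite -[_ *: _]addr0 innerB_linear innerB0 qY addr0 divfK//.
    by rewrite gt_eqF// innerY_gt0.
  move=> k ki; rewrite -[_ *: _]addr0 innerB_linear innerB0 qY.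
  by have [_ _ _ /(_ _ _ ki) ->] := hY j; rewrite mulr0 addr0.
have Kr : K r by apply: IH rm => // j i jm; apply: KY; exact: ltnW.
apply: Keq (_ : eq_boundary (1 *: (\sum_i c i *: @Y m i) + r) p) _.
  by move=> x y xy; rewrite scale1r eval2D -(eqI_eq_boundary pr xy) eval2B subrK.
apply: (KD) Kr; elim/big_rec: _ => // i u _ Ku.
by apply: KD Ku; exact: KY.
Qed.

End BoundarySpan.

(** * Polar coordinates for the maximum norm *)

Section Scaling.
Context {R : realType}.
Local Notation mu := (@lebesgue_measure R).

Lemma integral_scale (r : R) (k : R -> R) : 0 <= r -> continuous k ->
  (\int[mu]_(y in `[(- r)%R, r]) (k (y / r)%R)%:E =
   r%:E * \int[mu]_(t in `[(-1)%R, 1%R]) (k t)%:E)%E.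
Proof.
rewrite le_eqVlt => /predU1P[<- _|r0 ck].
  by rewrite oppr0 set_itv1 integral_set1 mul0e.
(* The substitution y = r t on [-1, 1]. *)
have dF : derive1 (fun t : R => r * t) = cst r.
  apply/funext => t; rewrite derive1E.
  by rewrite deriveM// derive_id derive_cst scaler0 addr0 /GRing.scale/= mulr1.
have cr (t : R) : {for t, continuous (fun t : R => r * t)}.
  by apply: cvgM; [exact: cvg_cst|exact: cvg_id].
have -> : - r = r * -1 by rewrite mulrN1.
rewrite -[in X in Interval _ X](mulr1 r).
rewrite (@integration_by_substitution_increasing _ (fun t : R => r * t)); first last.
- apply: continuous_subspaceT => t; apply: continuous_comp; last exact: ck.
  by apply: cvgM; [exact: cvg_id|exact: cvg_cst].
- split=> [t _| |].
  + exact: derivableM.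
  + exact/cvg_at_right_filter/cr.
  + exact/cvg_at_left_filter/cr.
- by rewrite dF; exact: is_cvg_cst.
- by rewrite dF; exact: is_cvg_cst.
- by rewrite dF => t _; exact: cvg_cst.
- by move=> x y _ _ xy; rewrite ltr_pM2l.
- by lra.
rewrite -integralZl//; last first.
  apply: continuous_compact_integrable; first exact: segment_compact.
  exact: continuous_subspaceT.
apply: eq_integral => t _; rewrite dF /= -EFinM mulrC; congr (_ * k _)%:E.
by rewrite mulrAC divff ?mul1r// gt_eqF.
Qed.

End Scaling.

Section Sector.
Context {R : realType}.
Local Notation mu := (@lebesgue_measure R).
Variables (a : R -> R) (k : R -> R -> R).
Hypothesis ma : measurable_fun setT a.
Hypothesis a0 : forall s, 0 <= a s.
Hypothesis aout : forall s : R, ~~ (0 <= s <= 1) -> a s = 0.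
Hypothesis ck : forall e : R, e = 1 \/ e = -1 -> continuous (k e).
Hypothesis k0 : forall e t, 0 <= k e t.

Let K e := (\int[mu]_(t in `[(-1)%R, 1%R]) (k e t)%:E)%E.

Let K0 e : (0 <= K e)%E.
Proof. by apply: integral_ge0 => t _; rewrite lee_fin k0. Qed.

Let V e (x : R) := ((`|x| * a `|x|)%:E * K e)%E.

Let V0 e x : (0 <= V e x)%E.
Proof. by rewrite mule_ge0// lee_fin mulr_ge0. Qed.

Let mra : measurable_fun setT (fun x : R => `|x| * a `|x|).
Proof.
apply: measurable_funM; first exact: normr_measurable.
by apply: measurableT_comp => //; exact: normr_measurable.
Qed.

Let mV e : measurable_fun setT (V e).
Proof. by apply: emeasurable_funM => //; exact/measurable_EFinP. Qed.

Let intV e : (\int[mu]_(x in `[0%R, +oo[) V e x =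
  \int[mu]_(x in `[0%R, 1%R]) (x * a x)%:E * K e)%E.
Proof.
rewrite ge0_integralZr//; last first.
- by move=> x _; rewrite lee_fin mulr_ge0.
- exact/measurable_EFinP/measurable_funTS.
congr (_ * _)%E; rewrite integral_mkcond [RHS]integral_mkcond.
apply: eq_integral => x _; rewrite !patchE.
case: ifPn => [|]; rewrite ?inE/= ?notin_setE/= !in_itv/=.
  rewrite andbT => x0; case: ifPn; rewrite ?inE/= ?notin_setE/= in_itv/=.
    by rewrite ger0_norm.
  by move=> /negP x1; rewrite ger0_norm// aout ?mulr0.
rewrite andbT => x0; case: ifPn; rewrite ?inE/= ?notin_setE/= in_itv//=.
by move=> /andP[].
Qed.

(** The contribution of the two opposite sides of the square on which the outer
    variable is extremal.  The inner integral is rescaled to [-1, 1], which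
    produces the Jacobian [`|x|]; the outer one is folded at 0.  The boolean
    selects the closed or the open sector, so that the diagonals can be given
    to one of the two pairs of sides. *)
Lemma integral_sector (b : bool) :
  (\int[mu]_x \int[mu]_y
     (if `|y| < `|x| ?<= if b then a `|x| * k (x / `|x|) (y / `|x|) else 0)%:E =
   \int[mu]_(x in `[0%R, 1%R]) (x * a x)%:E * (K 1 + K (-1)))%E.
Proof.
have sgn1 (x : R) : x != 0 -> x / `|x| = 1 \/ x / `|x| = -1.
  move=> x0; have [x_gt0|x_lt0|xE] := ltgtP x 0.
  - by right; rewrite ltr0_norm// invrN mulrN divff// lt_eqF.
  - by left; rewrite gtr0_norm// divff// gt_eqF.
  - by rewrite xE eqxx in x0.
have inner (x : R) : (\int[mu]_y
     (if `|y| < `|x| ?<= if b then a `|x| * k (x / `|x|) (y / `|x|) else 0)%:E =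
     V (x / `|x|)%R x)%E.
  (* At x = 0 the sector is at most a point and the Jacobian is zero. *)
  have [->|x0] := eqVneq x 0.
    rewrite /V normr0 !mul0r mul0e.
    rewrite (_ : (fun y => _) =
        (fun y => (a 0 * k 0 (y / 0))%:E) \_ [set y | y == 0 /\ b]).
      by rewrite -integral_mkcond; apply: (@integral_Sset1 _ _ _ 0) => y [/eqP].
    apply/funext => y; rewrite patchE.
    have -> : (y \in [set y : R | y == 0 /\ b]) = (`|y| < 0 ?<= if b).
      apply/idP/idP; rewrite inE/=; case: (b); rewrite /= ?normr_le0 ?ltNge ?normr_ge0//;
        by case.
    by case: ifP.
  pose g := (fun y : R => (a `|x|)%:E * (k (x / `|x|) (y / `|x|))%:E)%E.
  pose I := [set` Interval (BSide b (- `|x|)) (BSide (~~ b) `|x|)].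
  transitivity (\int[mu]_(y in I) g y)%E.
    rewrite [RHS]integral_mkcond; apply: eq_integral => y _; rewrite patchE.
    have -> : (y \in I) = (`|y| < `|x| ?<= if b).
      by rewrite /I; case: (b); apply/idP/idP;
        rewrite ?inE/= in_itv/= -?ler_norml -?ltr_norml.
    by case: ifP.
  have cke := ck (sgn1 _ x0).
  have mk : measurable_fun setT (fun y : R => k (x / `|x|) (y / `|x|)).
    apply: continuous_measurable_fun => y.
    by apply: continuous_comp; [exact: mulrr_continuous|exact: cke].
  have mg : measurable_fun setT g by apply: measurable_funeM; exact/measurable_EFinP.
  transitivity (\int[mu]_(y in `[(- `|x|)%R, `|x|%R]) g y)%E.
    by rewrite !integral_itv_bndoo//; exact: measurable_funTS.
  rewrite ge0_integralZl//; last first.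
  - by rewrite lee_fin.
  - by move=> y _; rewrite lee_fin.
  - exact/measurable_EFinP/measurable_funTS.
  by rewrite (integral_scale (normr_ge0 x) cke) muleA -EFinM mulrC.
under eq_integral do rewrite inner.
pose P : set R := `[0%R, +oo[%classic; pose N : set R := `]-oo, 0%R[%classic.
transitivity (\int[mu]_x ((V 1 \_ P) x + (V (-1) \_ N) x))%E.
  apply: eq_integral => x _; rewrite !patchE.
  have -> : (x \in P) = (0 <= x).
    by apply/idP/idP; rewrite /P inE/= in_itv/= andbT.
  have -> : (x \in N) = (x < 0) by apply/idP/idP; rewrite /N inE/= in_itv.
  have [x0|x0|->] := ltgtP x 0.
  - by rewrite add0e ltr0_norm// invrN mulrN divff// lt_eqF.
  - by rewrite adde0 gtr0_norm// divff// gt_eqF.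
  - by rewrite adde0 /V normr0 !mul0r !mul0e.
have mr e D : measurable D -> measurable_fun setT (V e \_ D).
  by move=> mD; apply/(measurable_restrictT _ mD)/measurable_funTS.
have V0r e D x : (0 <= (V e \_ D) x)%E by apply: erestrict_ge0.
rewrite ge0_integralD//; [|by apply: mr; exact: measurable_itv..].
rewrite -!integral_mkcond ge0_muleDr// -!intV; congr (_ + _)%E.
rewrite ge0_integration_by_substitution0//.
rewrite integral_itv_bndo_bndc; last exact: measurable_funTS.
by apply: eq_integral => x _; rewrite /V normrN.
Qed.

End Sector.

Section Polar.
Context {R : realType}.
Local Notation mu := (@lebesgue_measure R).
Local Notation mu2 := (@lebesgue2 R).

(** At the origin this is the origin, by the convention on division by zero. *)
Definition direction (z : R * R) : R * R := (z.1 / maxnorm z, z.2 / maxnorm z).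

Lemma measurable_maxnorm : measurable_fun setT (@maxnorm R).
Proof.
apply: measurable_maxr.
- by apply: measurableT_comp; [exact: normr_measurable|exact: measurable_fst].
- by apply: measurableT_comp; [exact: normr_measurable|exact: measurable_snd].
Qed.

Lemma maxnorm_ge0 (z : R * R) : 0 <= maxnorm z.
Proof. by rewrite /maxnorm le_max normr_ge0. Qed.

(** Inversion is measurable as the power function with exponent -1. *)
Lemma measurable_direction : measurable_fun setT direction.
Proof.
have mV : measurable_fun setT (fun z : R * R => (maxnorm z)^-1).
  rewrite (_ : (fun z => _) = fun z : R * R => maxnorm z `^ (-1)).
    apply: (measurableT_comp (f := fun x : R => x `^ (-1)));
      last exact: measurable_maxnorm.
    exact: measurable_powR.
  by apply/funext => z; rewrite powR_inv1// maxnorm_ge0.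
by apply/measurable_fun_pairP; split; exact: measurable_funM.
Qed.

Lemma measurable_polar (a : R -> R) (G : R * R -> R) :
  measurable_fun setT a -> measurable_fun setT G ->
  measurable_fun setT (fun z => a (maxnorm z) * G (direction z)).
Proof.
move=> ma mG; apply: measurable_funM.
- exact: measurableT_comp measurable_maxnorm.
- exact: measurableT_comp measurable_direction.
Qed.

(** The square is cut along its diagonals into the pair of sectors facing the
    vertical sides and the pair facing the horizontal ones; Tonelli's theorem is
    used in one order on the first pair and in the other order on the second.
    The integral runs over the plane because [a] vanishes outside [0, 1]. *)
Lemma ge0_integral_polar (a : R -> R) (G : R * R -> R) :
  measurable_fun setT a -> (forall s, 0 <= a s) ->
  (forall s : R, ~~ (0 <= s <= 1) -> a s = 0) ->
  measurable_fun setT G -> (forall z, 0 <= G z) ->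
  (forall e : R, e = 1 \/ e = -1 ->
    continuous (fun t => G (e, t)) /\ continuous (fun t => G (t, e))) ->
  (\int[mu2]_z (a (maxnorm z) * G (direction z))%:E =
   \int[mu]_(x in `[0%R, 1%R]) (x * a x)%:E *
   ((\int[mu]_(t in `[(-1)%R, 1%R]) (G (t, 1%R))%:E +
     \int[mu]_(t in `[(-1)%R, 1%R]) (G (t, (-1)%R))%:E) +
    (\int[mu]_(t in `[(-1)%R, 1%R]) (G (1%R, t))%:E +
     \int[mu]_(t in `[(-1)%R, 1%R]) (G ((-1)%R, t))%:E)))%E.
Proof.
move=> ma a0 aout mG G0 cG.
pose F z := a (maxnorm z) * G (direction z).
have mF : measurable_fun setT F by exact: measurable_polar.
have F0 z : 0 <= F z by rewrite mulr_ge0.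
have m1 : measurable_fun setT (fun z : R * R => `|z.1|).
  by apply: measurableT_comp; [exact: normr_measurable|exact: measurable_fst].
have m2 : measurable_fun setT (fun z : R * R => `|z.2|).
  by apply: measurableT_comp; [exact: normr_measurable|exact: measurable_snd].
pose FV z := if `|z.2| <= `|z.1| then F z else 0.
pose FH z := if `|z.1| < `|z.2| then F z else 0.
have mFV : measurable_fun setT (fun z => (FV z)%:E).
  apply/measurable_EFinP/measurable_fun_ifT => //.
  exact: measurable_fun_ler.
have mFH : measurable_fun setT (fun z => (FH z)%:E).
  apply/measurable_EFinP/measurable_fun_ifT => //.
  exact: measurable_fun_ltr.
have FV0 z : (0 <= (FV z)%:E)%E by rewrite /FV lee_fin; case: ifP.
have FH0 z : (0 <= (FH z)%:E)%E by rewrite /FH lee_fin; case: ifP.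
transitivity (\int[mu2]_z ((FV z)%:E + (FH z)%:E))%E.
  apply: eq_integral => z _; rewrite -EFinD /FV /FH; congr EFin.
  by case: leP; rewrite ?addr0 ?add0r.
rewrite ge0_integralD//.
rewrite [X in (X + _)%E](@fubini_tonelli1 _ _ _ _ R mu mu (fun z => (FV z)%:E))//.
rewrite [X in (_ + X)%E](@fubini_tonelli2 _ _ _ _ R mu mu (fun z => (FH z)%:E))//.
rewrite [RHS]ge0_muleDr; last 2 first.
  by rewrite adde_ge0// integral_ge0// => t _; rewrite lee_fin.
  by rewrite adde_ge0// integral_ge0// => t _; rewrite lee_fin.
rewrite addeC; congr (_ + _)%E.
- apply: etrans (@integral_sector _ a (fun e t => G (t, e)) ma a0 aout _ _ false);
    [|by move=> e /cG[]|by []].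
  apply: eq_integral => y _; apply: eq_integral => x _.
  rewrite /FH /F /direction /maxnorm /=; case: ifP => // xy.
  by rewrite max_r// ltW.
- apply: etrans (@integral_sector _ a (fun e t => G (e, t)) ma a0 aout _ _ true);
    [|by move=> e /cG[]|by []].
  apply: eq_integral => x _; apply: eq_integral => y _.
  rewrite /FV /F /direction /maxnorm /=; case: ifP => // xy.
  by rewrite max_l.
Qed.

End Polar.

(** * Factorization of weighted integrals over the square *)

Section PolarProduct.
Context {R : realType} (w : R -> R).
Local Notation mu := (@lebesgue_measure R).
Local Notation mu2 := (@lebesgue2 R).
Local Notation poly2 := (mpoly 2 R).
Hypothesis hw : weight_function w.
Implicit Types (A : {poly R}) (p : poly2).

Lemma measurable_eval2 p : measurable_fun setT (fun z : R * R => eval2 p z.1 z.2).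
Proof.
rewrite (_ : (fun z => _) = fun z : R * R => \sum_(m <- msupp p)
    mcoeff m p * \prod_i (if i == ord0 then z.1 else z.2) ^+ (m i)).
  apply: measurable_sum => m; apply: measurable_funM => //.
  apply: measurable_prod => i _; apply: measurable_funX.
  by case: (i == ord0); [exact: measurable_fst|exact: measurable_snd].
by apply/funext => z; rewrite /eval2 mevalE.
Qed.

Lemma measurable_horner A : measurable_fun setT (fun t : R => A.[t]).
Proof. by apply: continuous_measurable_fun; exact: continuous_horner. Qed.

Lemma square_maxnorm (z : R * R) : square z <-> maxnorm z <= 1.
Proof.
rewrite /square /maxnorm ge_max !ler_norml /=; split.
  by move=> []; rewrite /= !in_itv/= => -> ->.
by move=> /andP[z1 z2]; split; rewrite /= in_itv.
Qed.

Lemma measurable_square :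
  measurable (@square R : set (measurableTypeR R * measurableTypeR R)).
Proof. by apply: measurableX; exact: measurable_itv. Qed.

(** The factor [w] stays separate from the polynomial [A], so that the radial
    integral is linear in [A]. *)
Definition polar A p (z : R * R) : R :=
  A.[maxnorm z] * eval2 p (direction z).1 (direction z).2 * w (maxnorm z).

Definition polar_factors A p :=
  mu2.-integrable square (fun z => (polar A p z)%:E) /\
  \int[mu2]_(z in square) polar A p z =
    intpoly `[0, 1] w ('X * A) * boundary_int p.

Let wmom j : mu.-integrable `[0 : R, 1] (fun t => (t ^+ j * w t)%:E).
Proof. by have [_ _ + _] := hw; apply. Qed.

(** [ge0_integral_polar] for the radial function [A * w] cut off outside [0, 1];
    both factors are finite, which gives integrability as well. *)
Lemma polar_factors_ge0 A p : (forall t, 0 <= A.[t]) ->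
  (forall x y, 0 <= eval2 p x y) -> polar_factors A p.
Proof.
move=> A0 p0; have [mw w0 _ _] := hw.
pose I : set R := `[0, 1]%classic.
pose a := (fun t => A.[t] * w t) \_ I.
have mI : measurable I by exact: measurable_itv.
have ma : measurable_fun setT a.
  apply/(measurable_restrictT _ mI); apply: measurable_funM => //.
  by apply: measurable_funTS; exact: measurable_horner.
have a0 s : 0 <= a s.
  rewrite /a patchE; case: ifPn => // /[!inE] sI.
  by rewrite mulr_ge0// w0.
have aout (s : R) : ~~ (0 <= s <= 1) -> a s = 0.
  by move=> s01; rewrite /a patchE memNset// /I/= in_itv/=; exact/negP.
have cG (e : R) : e = 1 \/ e = -1 ->
    continuous (fun t => eval2 p e t) /\ continuous (fun t => eval2 p t e).
  move=> _; split.
    rewrite (_ : (fun t => _) = horner (restr ord0 e p)); first exact: continuous_horner.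
    by apply/funext => t; rewrite restr0E.
  rewrite (_ : (fun t => _) = horner (restr ord_max e p)); first exact: continuous_horner.
  by apply/funext => t; rewrite restr1E.
have := ge0_integral_polar ma a0 aout (measurable_eval2 p) (fun z => p0 z.1 z.2) cG.
have trE (F : R -> R) (T : {poly R}) : (forall t, F t = T.[t]) ->
    (\int[mu]_(t in `[(-1)%R, 1%R]) (F t)%:E)%E = (intpoly `[-1 : R, 1] (cst 1) T)%:E.
  move=> FT; rewrite /intpoly fineK.
    by apply: eq_integral => t _; rewrite FT mulr1.
  apply: integrable_fin_num => //; apply: integrable_poly => // j.
  exact: moments1.
rewrite (trE _ _ (fun t => esym (restr1E 1 p t))).
rewrite (trE _ _ (fun t => esym (restr1E (-1) p t))).
rewrite (trE _ _ (fun t => esym (restr0E 1 p t))).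
rewrite (trE _ _ (fun t => esym (restr0E (-1) p t))).
have -> : (\int[mu]_(x in `[0%R, 1%R]) (x * a x)%:E)%E = (intpoly `[0, 1] w ('X * A))%:E.
  rewrite /intpoly fineK; last first.
    by apply: integrable_fin_num => //; exact: integrable_poly.
  apply: eq_integral => t tI; rewrite /a patchE ifT// hornerM hornerX.
  by rewrite mulrA.
rewrite -!EFinD -!intpolyD//; try by move=> j; exact: moments1.
rewrite -EFinM => polE.
have eqf (z : R * R) : z \in (@square R) ->
    (polar A p z)%:E = (a (maxnorm z) * eval2 p (direction z).1 (direction z).2)%:E.
  move=> /set_mem/square_maxnorm z1; congr EFin; rewrite /polar mulrAC.
  congr (_ * _); rewrite /a patchE mem_set//.
  by rewrite /I/= in_itv/= maxnorm_ge0.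
have polsq : (\int[mu2]_(z in square) (polar A p z)%:E)%E =
    (intpoly `[0, 1] w ('X * A) * boundary_int p)%:E.
  rewrite -polE integral_mkcond; apply: eq_integral => z _; rewrite patchE.
  case: ifPn => [/eqf//|]; rewrite notin_setE => nz; rewrite aout ?mul0r//.
  by apply/negP => /andP[_ ?]; apply: nz; apply/square_maxnorm.
split; last by rewrite /Rintegral polsq.
apply/integrableP; split.
  apply: (eq_measurable_fun
    (fun z => (a (maxnorm z) * eval2 p (direction z).1 (direction z).2)%:E)).
    by move=> z zs; rewrite -eqf.
  apply/measurable_EFinP/measurable_funTS.
  exact: (measurable_polar ma (measurable_eval2 p)).
suff -> : (\int[mu2]_(z in square) `|(polar A p z)%:E| =
    \int[mu2]_(z in square) (polar A p z)%:E)%E by rewrite polsq ltry.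
apply: eq_integral => z zs.
by rewrite eqf// gee0_abs// lee_fin mulr_ge0.
Qed.

Lemma polar_factorsBl A B p :
  polar_factors A p -> polar_factors B p -> polar_factors (A - B) p.
Proof.
move=> [iA eA] [iB eB].
have e : polar (A - B) p = fun z => polar A p z - polar B p z.
  by apply/funext => z; rewrite /polar hornerD hornerN !mulrBl.
split; rewrite e.
  have := integrableB measurable_square iA iB.
  by apply: eq_integrable => //; exact: measurable_square.
rewrite (RintegralB measurable_square iA iB).
by rewrite eA eB mulrBr -[- ('X * B)]scaleN1r intpolyD// intpolyZ// mulN1r mulrBl.
Qed.

Lemma boundary_intB p q : boundary_int (p - q) = boundary_int p - boundary_int q.
Proof.
have := innerB_linear 1 (-1) q p.
by rewrite !innerBE !mulr1 scaleN1r mulN1r addrC => ->; rewrite addrC.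
Qed.

Lemma polar_factorsBr A p q :
  polar_factors A p -> polar_factors A q -> polar_factors A (p - q).
Proof.
move=> [ip ep] [iq eq].
have e : polar A (p - q) = fun z => polar A p z - polar A q z.
  by apply/funext => z; rewrite /polar eval2B mulrBr mulrBl.
split; rewrite e.
  have := integrableB measurable_square ip iq.
  by apply: eq_integrable => //; exact: measurable_square.
rewrite (RintegralB measurable_square ip iq).
by rewrite ep eq boundary_intB mulrBr.
Qed.

(** Both sides are linear in [A] and in [p], and in any commutative ring where 2
    is invertible an element is a difference of two squares,
    x = ((x + 1)/2)^2 - ((x - 1)/2)^2; this reduces to nonnegative factors. *)
Lemma polar_factorsP A p : polar_factors A p.
Proof.
have sqE (S : comNzRingType) (x h : S) : h + h = 1 ->
    x = (h * (x + 1)) ^+ 2 - (h * (x - 1)) ^+ 2.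
  move=> h2; transitivity ((h + h) ^+ 2 * x); first by rewrite h2 expr1n mul1r.
  ring.
have hA : (2^-1)%:P + (2^-1)%:P = 1 :> {poly R}.
  by rewrite -rmorphD/=; congr polyC; field.
have hp : mpolyC 2 (2^-1 : R) + mpolyC 2 2^-1 = 1.
  by rewrite -mpolyCD -mpolyC1; congr mpolyC; field.
rewrite (sqE _ A _ hA) (sqE _ p _ hp).
apply: polar_factorsBl; apply: polar_factorsBr; apply: polar_factors_ge0;
  by move=> *; rewrite ?horner_exp ?expr2 ?eval2M -?expr2 ?sqr_ge0// -expr2 sqr_ge0.
Qed.

End PolarProduct.

(** * Closed linear spans in a weighted L2 space *)

Section ClosedSpan.
Context d (T : measurableType d) (R : realType).
Variables (mu : {measure set T -> \bar R}) (D : set T) (W : T -> R).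
Variables (I : Type) (e : I -> T -> R).
Hypothesis mD : measurable D.
Hypothesis mW : measurable_fun D W.
Hypothesis W0 : forall z, D z -> 0 <= W z.
Hypothesis me : forall a, measurable_fun D (e a).
Implicit Types f g : T -> R.

Definition sqnorm f : \bar R := (\int[mu]_(z in D) (f z ^+ 2 * W z)%:E)%E.

Definition lincomb (l : seq (R * I)) (z : T) : R := \sum_(x <- l) x.1 * e x.2 z.

(** Membership in the closure of the span of the family [e] in L2(W).  The
    squared norm is kept in the extended reals, where monotonicity needs no
    integrability. *)
Definition spanned f : Prop :=
  measurable_fun D f /\
  forall eps : R, 0 < eps ->
    exists l, (sqnorm (fun z => (f z - lincomb l z)%R) <= eps%:E)%E.

Lemma measurable_lincomb l : measurable_fun D (lincomb l).
Proof.
by apply: measurable_sum => x; apply: measurable_funM.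
Qed.

Lemma measurable_sqW f : measurable_fun D f ->
  measurable_fun D (fun z => (f z ^+ 2 * W z)%:E).
Proof.
by move=> mf; apply/measurable_EFinP/measurable_funM => //; exact: measurable_funX.
Qed.

Lemma sqW_ge0 f z : D z -> (0 <= (f z ^+ 2 * W z)%:E)%E.
Proof. by move=> Dz; rewrite lee_fin mulr_ge0 ?sqr_ge0 ?W0. Qed.

Lemma eq_sqnorm f g : (forall z, D z -> f z = g z) -> sqnorm f = sqnorm g.
Proof. by move=> fg; apply: eq_integral => z /set_mem Dz; rewrite fg. Qed.

Lemma sqnormZ c f : measurable_fun D f ->
  sqnorm (fun z => c * f z) = ((c ^+ 2)%:E * sqnorm f)%E.
Proof.
move=> mf; rewrite /sqnorm -ge0_integralZl//.
- by apply: eq_integral => z _; rewrite -EFinM mulrA exprMn.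
- exact: measurable_sqW.
- by move=> z; exact: sqW_ge0.
- by rewrite lee_fin sqr_ge0.
Qed.

(** A triangle inequality for the squared norm: (a + b)^2 <= 2 a^2 + 2 b^2. *)
Lemma sqnormD f g : measurable_fun D f -> measurable_fun D g ->
  (sqnorm (fun z => (f z + g z)%R) <= 2%:E * (sqnorm f + sqnorm g))%E.
Proof.
move=> mf mg; rewrite /sqnorm -ge0_integralD//; first last.
- exact: measurable_sqW.
- by move=> z; exact: sqW_ge0.
- exact: measurable_sqW.
- by move=> z; exact: sqW_ge0.
rewrite -ge0_integralZl//; last first.
- by move=> z Dz; rewrite adde_ge0// sqW_ge0.
- by apply: emeasurable_funD; exact: measurable_sqW.
apply: ge0_le_integral => //.
- by move=> z Dz; exact: (sqW_ge0 (fun z => f z + g z)).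
- by apply: measurable_sqW; exact: measurable_funD.
- by apply: measurable_funeM; apply: emeasurable_funD; exact: measurable_sqW.
move=> z Dz; rewrite -EFinD -EFinM lee_fin -mulrDl mulrA ler_wpM2r ?W0//.
rewrite -subr_ge0 (_ : _ - _ = (f z - g z) ^+ 2) ?sqr_ge0//; ring.
Qed.

Lemma spanned_approx f : measurable_fun D f ->
  (forall eps : R, 0 < eps -> exists2 g, spanned g &
    (sqnorm (fun z => (f z - g z)%R) <= eps%:E)%E) -> spanned f.
Proof.
move=> mf H; split=> // eps e0; have e4 : 0 < eps / 4 by rewrite divr_gt0.
have [g [mg sg] fg] := H _ e4; have [l gl] := sg _ e4.
exists l; rewrite (@eq_sqnorm _ (fun z => (f z - g z) + (g z - lincomb l z))); last first.
  by move=> z _; rewrite addrA subrK.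
apply: le_trans (sqnormD _ _) _.
- exact: measurable_funB.
- by apply: measurable_funB => //; exact: measurable_lincomb.
have -> : eps%:E = (2%:E * ((eps / 4)%:E + (eps / 4)%:E))%E.
  by rewrite -EFinD -EFinM; congr EFin; field.
by rewrite lee_pmul2l// leeD.
Qed.

Lemma spanned0 : spanned (fun=> 0).
Proof.
split; first exact: measurable_cst.
move=> eps e0; exists [::]; rewrite /sqnorm integral0_eq ?lee_fin ?ltW//.
by move=> z _; rewrite /lincomb big_nil subrr expr0n mul0r.
Qed.

Lemma spanned_gen a : spanned (e a).
Proof.
split=> // eps e0; exists [:: (1, a)]; rewrite /sqnorm integral0_eq ?lee_fin ?ltW//.
by move=> z _; rewrite /lincomb big_seq1 mul1r subrr expr0n mul0r.
Qed.

Lemma spanned_linear c f g : spanned f -> spanned g -> spanned (fun z => c * f z + g z).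
Proof.
move=> [mf sf] [mg sg]; have mcf : measurable_fun D (fun z => c * f z + g z).
  by apply: measurable_funD => //; exact: measurable_funM.
split=> // eps e0.
pose C := c ^+ 2 + 1; have C0 : 0 < C by rewrite ltr_wpDl ?sqr_ge0.
have [|l fl] := sf (eps / (4 * C)); first by rewrite divr_gt0// mulr_gt0.
have [|l' gl] := sg (eps / 4); first by rewrite divr_gt0.
exists ([seq (c * x.1, x.2) | x <- l] ++ l').
rewrite (@eq_sqnorm _ (fun z => c * (f z - lincomb l z) + (g z - lincomb l' z))); last first.
  move=> z _; rewrite /lincomb big_cat/= big_map mulrBr addrACA opprD.
  congr (_ + (- _ - _)); rewrite big_distrr/=.
  by apply: eq_bigr => x _; rewrite mulrA.
have mfl : measurable_fun D (fun z => f z - lincomb l z).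
  by apply: measurable_funB => //; exact: measurable_lincomb.
apply: le_trans (sqnormD _ _) _.
- exact: measurable_funM.
- by apply: measurable_funB => //; exact: measurable_lincomb.
have -> : eps%:E = (2%:E * ((eps / 4)%:E + (eps / 4)%:E))%E.
  by rewrite -EFinD -EFinM; congr EFin; field.
rewrite lee_pmul2l// leeD// sqnormZ//.
apply: (@le_trans _ _ ((c ^+ 2)%:E * (eps / (4 * C))%:E)%E).
  by rewrite lee_wpmul2l// lee_fin sqr_ge0.
rewrite -EFinM lee_fin [leLHS](_ : _ = eps / 4 * (c ^+ 2 / C)); last first.
  by field; rewrite gt_eqF.
by apply: ler_piMr; [rewrite divr_ge0 ?ltW|rewrite ler_pdivrMr// mul1r lerDl].
Qed.

Lemma spannedZ c f : spanned f -> spanned (fun z => c * f z).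
Proof.
move=> sf; have := spanned_linear c sf spanned0.
by under eq_fun do rewrite addr0.
Qed.

Lemma spannedD f g : spanned f -> spanned g -> spanned (fun z => f z + g z).
Proof.
move=> sf sg; have := spanned_linear 1 sf sg.
by under eq_fun do rewrite mul1r.
Qed.

Lemma spannedB f g : spanned f -> spanned g -> spanned (fun z => f z - g z).
Proof.
move=> sf sg; have := spanned_linear (-1) sg sf.
by under eq_fun do rewrite mulN1r addrC.
Qed.

Lemma spanned_sum (J : Type) (s : seq J) (P : pred J) (F : J -> T -> R) :
  (forall j, P j -> spanned (F j)) -> spanned (fun z => \sum_(j <- s | P j) F j z).
Proof.
move=> sF; elim: s => [|j s IH].
  by under eq_fun do rewrite big_nil; exact: spanned0.
under eq_fun do rewrite big_cons; have [radial_orthogonal|//] := boolP (P j).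
by apply: spannedD => //; exact: sF.
Qed.

(** Dominated convergence for the functions [(f - f_ n)^2 W]. *)
Lemma spanned_cvg (f_ : nat -> T -> R) f (h : T -> R) :
  measurable_fun D f -> (forall n, spanned (f_ n)) ->
  {ae mu, forall z, D z -> f_ ^~ z @ \oo --> f z} ->
  mu.-integrable D (EFin \o h) ->
  {ae mu, forall z n, D z -> (f_ n z - f z) ^+ 2 * W z <= h z} ->
  spanned f.
Proof.
move=> mf sf ff ih fh; apply: spanned_approx => // eps e0.
pose F n z := ((f z - f_ n z) ^+ 2 * W z)%:E.
have mf_ n : measurable_fun D (f_ n) by have [] := sf n.
have [|||||_ _] := @dominated_convergence _ _ _ mu D mD F (cst 0%E) (EFin \o h).
- by move=> n; apply: measurable_sqW; exact: measurable_funB.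
- exact: measurable_cst.
- apply: filterS ff => z + Dz => /(_ Dz) fz; rewrite /F /=.
  apply: cvg_EFin; first exact: nearW.
  rewrite [X in _ --> X](_ : _ = (f z - f z) ^+ 2 * W z); last first.
    by rewrite subrr expr0n mul0r.
  apply: (@cvgM _ _ _ _ (fun n => (f z - f_ n z) ^+ 2) (cst (W z))); last exact: cvg_cst.
  under eq_cvg do rewrite /= expr2.
  by rewrite expr2; apply: cvgM; apply: cvgB => //; exact: cvg_cst.
- exact: ih.
- apply: filterS fh => z + n Dz => /(_ n Dz) fz; rewrite /F /=.
  move: fz; rewrite -sqrrN opprB => fz.
  rewrite lee_fin ger0_norm; last by rewrite mulr_ge0 ?sqr_ge0 ?W0.
  exact: fz.
rewrite integral0 => /fine_cvgP[fin /cvgrPdist_le /(_ _ e0)] le.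
have [N _ HN] := filterI fin le; have [/= finN leN] := HN N (leqnn N).
exists (f_ N) => //; rewrite /sqnorm -[leLHS]fineK// lee_fin.
by move: leN; rewrite sub0r normrN; apply: le_trans; exact: ler_norm.
Qed.

Lemma spanned_ae_eq f g : spanned f -> measurable_fun D g ->
  {ae mu, forall z, D z -> f z = g z} -> spanned g.
Proof.
move=> sf mg fg; apply: (@spanned_cvg (fun=> f) g (cst 0)) => //.
- by apply: filterS fg => z + Dz => /(_ Dz) ->; exact: cvg_cst.
- exact: integrable0.
- by apply: filterS fg => z + n Dz => /(_ Dz) ->; rewrite subrr expr0n mul0r.
Qed.

Lemma eq_spanned f g : (forall z, D z -> f z = g z) -> spanned f -> spanned g.
Proof.
move=> fg sf; apply: (spanned_ae_eq sf); last exact: aeW.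
apply: eq_measurable_fun (sf.1) => z /set_mem Dz; exact: fg.
Qed.

Hypothesis iW : mu.-integrable D (EFin \o W).

Lemma spanned_bounded_cvg (f_ : nat -> T -> R) f (C : R) :
  measurable_fun D f -> (forall n, spanned (f_ n)) ->
  {ae mu, forall z, D z -> f_ ^~ z @ \oo --> f z} ->
  (forall n z, D z -> `|f_ n z - f z| <= C) -> spanned f.
Proof.
move=> mf sf ff fC; apply: (@spanned_cvg f_ f (fun z => C ^+ 2 * W z)) => //.
- have := integrableZl mD (C ^+ 2) iW.
  by apply: eq_integrable.
- apply: aeW => z n Dz; rewrite ler_wpM2r ?W0// -real_normK ?num_real//.
  by rewrite lerXn2r ?nnegrE ?(le_trans _ (fC n z Dz))// fC.
Qed.

(** The sets [B] whose indicator, pulled back by [phi] and multiplied by [h],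
    lies in the closed span form a Dynkin class.  The multiplier [h] makes it
    possible to pass to products one coordinate at a time. *)
Lemma spanned_dynkin d' (T' : measurableType d') (phi : T -> T') (h : T -> R)
    (G : set (set T')) :
  measurable_fun setT phi -> (forall z, D z -> `|h z| <= 1) ->
  @measurable _ T' = <<s G >> -> setI_closed G -> spanned h ->
  (forall B, G B -> spanned (fun z => h z * \1_B (phi z))) ->
  forall B, measurable B -> spanned (fun z => h z * \1_B (phi z)).
Proof.
move=> mphi h1 GE GI sh sG B mB.
have mh : measurable_fun D h by case: sh.
have mind A : measurable A -> measurable_fun D (fun z => \1_A (phi z) : R).
  by move=> mA; apply/measurable_funTS/measurableT_comp => //; exact: measurable_indic.
apply: (dynkin_induction GE GI _ sG); last by rewrite -GE.
- by apply: eq_spanned sh => z _; rewrite indicT mulr1.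
- move=> S mS sS; apply: eq_spanned (spannedB sh sS) => z _.
  by rewrite !indicE in_setC; case: (_ \in _); rewrite /= ?mulr1 ?mulr0 ?subrr ?subr0.
- move=> F mF tF sF.
  (* The partial sums of the indicators are eventually constant at every
     point, and take the values 0 and 1 only. *)
  pose S n z := \sum_(i < n) \1_(F i) (phi z) : R.
  have SE k n z : F k (phi z) -> S n z = (k < n)%:R.
    move=> Fk; rewrite /S; case: ltnP => kn.
      rewrite (bigD1 (Ordinal kn))//= indicE mem_set// big1 ?addr0// => i ik.
      rewrite indicE memNset// => Fi; move/eqP: ik; apply; apply/val_inj => /=.
      by apply: (tF i k) => //; exists (phi z).
    rewrite big1// => i _; rewrite indicE memNset// => Fi.
    have ik : i = k :> nat by apply: (tF i k) => //; exists (phi z).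
    by have := ltn_ord i; rewrite ik ltnNge kn.
  have S0 n z : ~ (\bigcup_k F k) (phi z) -> S n z = 0.
    move=> nF; rewrite /S big1// => i _; rewrite indicE memNset// => Fi.
    by apply: nF; exists i.
  apply: (@spanned_bounded_cvg (fun n z => h z * S n z) _ 1).
  + by apply: measurable_funM => //; apply: mind; exact: bigcup_measurable.
  + move=> n; rewrite (_ : (fun z => _) = fun z => \sum_(i < n) h z * \1_(F i) (phi z)).
      by apply: spanned_sum.
    by apply/funext => z; rewrite /S big_distrr.
  + apply: aeW => z _.
    have [[k _ Fk]|nF] := pselect ((\bigcup_k F k) (phi z)).
      apply: cvg_near_cst; exists k.+1 => // n /= kn.
      by rewrite (SE k)// kn indicE mem_set//; exists k.
    by apply: cvg_near_cst; apply: nearW => n; rewrite S0// indicE memNset.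
  + move=> n z Dz; rewrite -mulrBr normrM mulr_ile1//; first exact: h1.
    have [[k _ Fk]|nF] := pselect ((\bigcup_k F k) (phi z)).
      rewrite (SE k)// indicE mem_set/=; last by exists k.
      by case: ltnP => _; rewrite ?subrr ?sub0r ?normrN ?normr0 ?normr1.
    by rewrite S0// indicE memNset// subrr normr0.
Qed.

Hypothesis sind : forall A, measurable A -> spanned (\1_A).

Import HBNNSimple.

(** Simple functions increasing to [f] satisfy (f_n - f)^2 <= f^2, so [f^2 W]
    dominates. *)
Lemma spanned_ge0 f : measurable_fun D f -> (forall z, D z -> 0 <= f z) ->
  mu.-integrable D (fun z => (f z ^+ 2 * W z)%:E) -> spanned f.
Proof.
move=> mf f0 fi.
have mEf : measurable_fun D (EFin \o f) by exact/measurable_EFinP.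
have f0' x : D x -> (0 <= (EFin \o f) x)%E by move=> Dx; rewrite lee_fin f0.
pose s n : T -> R := nnsfun_approx mD mEf n.
have sle n z : D z -> 0 <= s n z <= f z.
  move=> Dz; rewrite /s fun_ge0/= -lee_fin nnsfun_approxE.
  exact: (@le_approx _ _ _ _ (EFin \o f) n z f0' Dz).
apply: (@spanned_cvg s f (fun z => f z ^+ 2 * W z)) => //.
- move=> n; rewrite (_ : s n = fun z =>
    \sum_(y <- finmap.enum_fset (fset_set (range (s n))))
    y * \1_(s n @^-1` [set y]) z).
    apply: spanned_sum => y _; apply: spannedZ; apply: sind.
    exact: measurable_funPTI.
  apply/funext => z; rewrite {1}/s fimfunE fsbig_finite//.
- apply: aeW => z Dz; have := cvg_nnsfun_approx mD mEf f0' Dz.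
  by move/fine_cvgP => [_].
- apply: aeW => z n Dz; rewrite ler_wpM2r ?W0//.
  have /andP[s0 sf] := sle n z Dz.
  rewrite -sqrrN opprB lerXn2r ?nnegrE ?subr_ge0 ?f0//.
  by rewrite lerBlDr lerDl.
Qed.

Lemma spanned_all f : measurable_fun D f ->
  mu.-integrable D (fun z => (f z ^+ 2 * W z)%:E) -> spanned f.
Proof.
move=> mf fi.
have H (g : T -> R) : measurable_fun D g -> (forall z, 0 <= g z <= `|f z|) -> spanned g.
  move=> mg gf; apply: spanned_ge0 => //.
    by move=> z _; have /andP[] := gf z.
  apply: le_integrable fi => //; first exact: measurable_sqW.
  move=> z Dz; rewrite !gee0_abs ?sqW_ge0// lee_fin ler_wpM2r ?W0//.
  have /andP[g0 gle] := gf z.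
  by rewrite -[leRHS]real_normK ?num_real// lerXn2r ?nnegrE.
apply: eq_spanned (spannedB (H (fun z => Num.max (f z) 0) _ _)
  (H (fun z => Num.max (- f z) 0) _ _)).
- move=> z _ /=; case: (leP 0 (f z)) => fz.
    by rewrite max_r ?subr0// oppr_le0.
  by rewrite max_l ?oppr_ge0 ?ltW// sub0r opprK.
- exact: measurable_maxr.
- by move=> z; rewrite le_max lexx orbT ge_max normr_ge0 ler_norm.
- by apply: measurable_maxr => //; exact: measurable_funN.
- by move=> z; rewrite le_max lexx orbT ge_max normr_ge0 -normrN ler_norm.
Qed.

End ClosedSpan.

(** * Polynomials approximating the indicator of a ray *)

Section RayApproximation.
Context {R : realType}.
Implicit Types t x : R.

Lemma bernoulli_le m t : 0 <= t <= 1 -> 1 - m%:R * t <= (1 - t) ^+ m.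
Proof.
move=> /andP[t0 t1]; elim: m => [|m IH]; first by rewrite mul0r subr0 expr0.
rewrite exprSr; apply: (@le_trans _ _ ((1 - m%:R * t) * (1 - t))).
  rewrite -subr_ge0 -natr1 (_ : _ - _ = m%:R * t ^+ 2); last by ring.
  by rewrite mulr_ge0 ?sqr_ge0.
by rewrite ler_wpM2r// subr_ge0.
Qed.

Lemma bernoulli_inv m t : 0 <= t <= 1 -> (1 - t) ^+ m * (1 + m%:R * t) <= 1.
Proof.
move=> /andP[t0 t1]; elim: m => [|m IH]; first by rewrite mul0r addr0 expr0 mul1r.
apply: le_trans IH; rewrite exprSr -mulrA ler_wpM2l//.
  by rewrite exprn_ge0// subr_ge0.
rewrite -subr_ge0 -natr1 (_ : _ - _ = (m%:R + 1) * t ^+ 2); last by ring.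
by rewrite mulr_ge0 ?sqr_ge0 ?addr_ge0.
Qed.

(** The exponents balance so that [2 ^ n * t ^ n] is [(2 * t) ^ n], which tends to
    0 or to infinity according to the side of 1/2 on which t lies; Bernoulli's
    inequality then gives the limits 1 and 0. *)
Definition threshold n t : R := (1 - t ^+ n) ^+ (2 ^ n).

Lemma threshold_01 n t : 0 <= t <= 1 -> 0 <= threshold n t <= 1.
Proof.
move=> /andP[t0 t1]; have tn : 0 <= 1 - t ^+ n by rewrite subr_ge0 exprn_ile1.
by rewrite exprn_ge0//= exprn_ile1// gerBl exprn_ge0.
Qed.

Lemma cvg_threshold t : 0 <= t <= 1 -> t != 2^-1 ->
  threshold ^~ t @ \oo --> ((t < 2^-1)%R%:R : R).
Proof.
move=> t01; have /andP[t0 t1] := t01.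
have tn n : 0 <= t ^+ n <= 1 by rewrite exprn_ge0//= exprn_ile1.
rewrite neq_lt => /orP[tl|tg].
  rewrite tl; apply: (@squeeze_cvgr _ _ _ _ (fun n => 1 - (2 * t) ^+ n) (cst 1)).
  - apply: nearW => n; have /andP[_ ->] := threshold_01 n t01; rewrite andbT.
    by rewrite exprMn -natrX; exact: bernoulli_le.
  - rewrite -[X in _ --> X]subr0; apply: cvgB; first exact: cvg_cst.
    apply: cvg_expr; rewrite ger0_norm ?mulr_ge0//.
    by rewrite mulrC -ltr_pdivlMr// div1r.
  - exact: cvg_cst.
have t_gt0 : 0 < t by apply: lt_trans tg.
rewrite ltNge ltW//=; apply: (@squeeze_cvgr _ _ _ _ (cst 0) (fun n => ((2 * t)^-1) ^+ n)).
- apply: nearW => n; have /andP[-> _] /= := threshold_01 n t01.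
  have p0 : 0 < (2 * t) ^+ n by rewrite exprn_gt0// mulr_gt0.
  rewrite exprVn -(ler_pM2r p0) mulVf ?gt_eqF//.
  apply: le_trans (bernoulli_inv (2 ^ n) (tn n)).
  rewrite ler_wpM2l//; first by have /andP[] := threshold_01 n t01.
  by rewrite natrX -exprMn lerDr.
- exact: cvg_cst.
- apply: cvg_expr; rewrite ger0_norm ?invr_ge0 ?mulr_ge0//.
  by rewrite invf_lt1 ?mulr_gt0// mulrC -ltr_pdivrMr// div1r.
Qed.

(** An affine map that sends [a] to 1/2 and [-1, 1] into [0, 1]. *)
Definition rescale (a x : R) := (x - a) / (2 * (1 + `|a|)) + 2^-1.

Lemma rescale_01 a x : -1 <= x <= 1 -> 0 <= rescale a x <= 1.
Proof.
move=> x1; have a0 : 0 < 1 + `|a| by rewrite ltr_pwDl.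
have : `|x - a| <= 1 + `|a| by rewrite (le_trans (ler_normB _ _))// lerD2r ler_norml.
rewrite ler_norml => /andP[h1 h2].
have e : rescale a x = (x - a + (1 + `|a|)) / (2 * (1 + `|a|)).
  by rewrite /rescale; field; rewrite gt_eqF.
have d0 : 0 < 2 * (1 + `|a|) by rewrite mulr_gt0.
rewrite e ler_pdivrMr// mul1r; apply/andP; split; last by lra.
by rewrite divr_ge0 ?(ltW d0)//; lra.
Qed.

Lemma rescale_lt a x : (rescale a x < 2^-1) = (x < a).
Proof.
by rewrite /rescale -ltrBrDr subrr pmulr_llt0 ?subr_lt0//.
Qed.

Lemma rescale_eq a x : (rescale a x == 2^-1) = (x == a).
Proof.
rewrite /rescale -subr_eq0 addrK mulf_eq0 subr_eq0 invr_eq0 mulf_eq0.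
by rewrite pnatr_eq0 /= [X in _ || X]gt_eqF ?orbF// ltr_pwDl.
Qed.

(** Approximates the indicator of the ray of the numbers greater than [a]. *)
Definition ray_approx a n x : R := 1 - threshold n (rescale a x).

Lemma ray_approx_01 a n x : -1 <= x <= 1 -> 0 <= ray_approx a n x <= 1.
Proof.
move=> /(rescale_01 a)/(threshold_01 n)/andP[h1 h2].
by rewrite /ray_approx subr_ge0 h2 gerBl.
Qed.

Lemma cvg_ray_approx a x : -1 <= x <= 1 -> x != a ->
  ray_approx a ^~ x @ \oo --> (\1_`]a, +oo[ x : R).
Proof.
move=> x1 xa.
have -> : \1_`]a, +oo[ x = 1 - (rescale a x < 2^-1)%R%:R :> R.
  rewrite indicE rescale_lt mem_setE in_itv/= andbT.
  by move: xa; rewrite neq_lt; case: ltgtP => //=; rewrite ?subrr ?subr0.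
apply: cvgB; first exact: cvg_cst.
by apply: cvg_threshold; [exact: rescale_01|rewrite rescale_eq].
Qed.

Definition ray_mpoly (i : 'I_2) a n : mpoly 2 R :=
  1 - (1 - ((2 * (1 + `|a|))^-1 *: (mpolyX R (mnm1 i) - mpolyC 2 a)
            + mpolyC 2 2^-1) ^+ n) ^+ (2 ^ n).

Lemma eval2_ray_mpoly i a n (x y : R) :
  eval2 (ray_mpoly i a n) x y = ray_approx a n (if i == ord0 then x else y).
Proof.
rewrite /ray_mpoly /ray_approx /threshold /rescale /eval2.
rewrite !(rmorphB, rmorphXn, rmorph1, rmorphD)/= mevalZ rmorphB/= mevalXU !mevalC.
by rewrite [_^-1 * _]mulrC.
Qed.

Lemma eval2_ray_mpolyM a c n (x y : R) :
  eval2 (ray_mpoly ord_max c n * ray_mpoly ord0 a n) x y =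
  ray_approx c n y * ray_approx a n x.
Proof.
transitivity (eval2 (ray_mpoly ord_max c n) x y * eval2 (ray_mpoly ord0 a n) x y).
  exact: eval2M.
by congr (_ * _); exact: eval2_ray_mpoly.
Qed.

End RayApproximation.

(** * Density of the polynomials on the square *)

Section SquareDensity.
Context {R : realType}.
Local Notation mu := (@lebesgue_measure R).
Local Notation mu2 := (@lebesgue2 R).
Local Notation RT := (measurableTypeR R).
Local Notation T := (RT * RT)%type.
Variables (W : R * R -> R) (I : Type) (e : I -> R * R -> R).
Hypothesis mW : measurable_fun (square : set T) W.
Hypothesis W0 : forall z, square z -> 0 <= W z.
Hypothesis me : forall a, measurable_fun (square : set T) (e a).
Hypothesis iW : mu2.-integrable square (EFin \o W).
Local Notation spanned := (spanned mu2 square W e).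
Hypothesis poly_spanned : forall p, spanned (fun z => eval2 p z.1 z.2).

Let mD : measurable (square : set T) := @measurable_square R.

Lemma squareP (z : R * R) : square z -> -1 <= z.1 <= 1 /\ -1 <= z.2 <= 1.
Proof. by move=> []; rewrite /= !in_itv. Qed.

Lemma measurable_fst2 : measurable_fun (setT : set T) (fst : T -> RT).
Proof. exact: measurable_fst. Qed.

Lemma measurable_snd2 : measurable_fun (setT : set T) (snd : T -> RT).
Proof. exact: measurable_snd. Qed.

(** The lines on which [ray_approx] may converge to a wrong value are null. *)
Lemma lebesgue2_line (a b : R) : mu2 ([set a] `*` setT `|` setT `*` [set b]) = 0%E.
Proof.
have m1 : measurable ([set a] `*` setT : set T) by apply: measurableX.
have m2 : measurable (setT `*` [set b] : set T) by apply: measurableX.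
rewrite /lebesgue2 null_set_setU//.
  transitivity (mu [set a] * mu setT)%E; first exact: product_measure1E.
  by rewrite lebesgue_measure_set1 mul0e.
transitivity (mu setT * mu [set b])%E; first exact: product_measure1E.
by rewrite lebesgue_measure_set1 mule0.
Qed.

(** The product of the approximations of the two rays is a polynomial in (x, y)
    with values in [0, 1], and converges off two lines. *)
Lemma spanned_rays (a c : R) :
  spanned (fun z => \1_`]c, +oo[ z.2 * \1_`]a, +oo[ z.1).
Proof.
apply: (@spanned_bounded_cvg _ _ _ mu2 _ _ _ _ mD mW W0 me iW
  (fun n z => ray_approx c n z.2 * ray_approx a n z.1) _ 1).
- have mray (x : R) : measurable_fun (setT : set RT) (\1_`]x, +oo[ : RT -> R).
    by apply: measurable_indic; exact: measurable_itv.
  apply: measurable_funM; apply: measurable_funTS.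
  + exact: (measurableT_comp (mray c) measurable_snd2).
  + exact: (measurableT_comp (mray a) measurable_fst2).
- move=> n; apply: (eq_spanned mD mW W0 me)
    (poly_spanned (ray_mpoly ord_max c n * ray_mpoly ord0 a n)).
  by move=> z _; exact: eval2_ray_mpolyM.
- exists ([set a] `*` setT `|` setT `*` [set c]); split.
  + by apply: measurableU; apply: measurableX.
  + exact: lebesgue2_line.
  + move=> z /= /not_implyP[/squareP[z1 z2]] h; apply: contrapT => nl; apply: h.
    apply: cvgM; apply: cvg_ray_approx => //; apply/eqP => za; apply: nl.
    * by right.
    * by left.
- move=> n z /squareP[z1 z2]; rewrite !indicE.
  have /andP[h1 h2] := ray_approx_01 c n z2.
  have /andP[h3 h4] := ray_approx_01 a n z1.
  have h5 := mulr_ge0 h1 h3; have h6 := mulr_ile1 h1 h3 h2 h4.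
  have dist (b : bool) (v : R) : 0 <= v -> v <= 1 -> `|v - b%:R| <= 1.
    by move=> v0 v1; rewrite ler_norml; case: b => /=; apply/andP; split; lra.
  by rewrite -natrM mulnb; exact: dist.
Qed.

(** The square lies in the half-planes bounded by -2, so this choice of the ray
    turns a product of two indicators into a single one. *)
Lemma indic_ray_eq1 (x : R) : -1 <= x -> \1_`]-2, +oo[ x = 1 :> R.
Proof.
move=> x1; rewrite indicE mem_set//= in_itv/= andbT; lra.
Qed.

Lemma measurable_rays : @measurable _ RT = <<s @RGenOInfty.G R >>.
Proof. exact: RGenOInfty.measurableE. Qed.

Lemma rays_setI_closed : setI_closed (@RGenOInfty.G R).
Proof.
move=> _ _ [x ->] [y ->]; exists (Num.max x y); apply/seteqP; split=> t /=;
  by rewrite !in_itv/= !andbT gt_max => /andP.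
Qed.

(** Dynkin's theorem three times: in the first coordinate with a ray in the
    second, in the second coordinate with a Borel set in the first, and finally
    from rectangles to Borel sets of the plane. *)
Lemma spanned_indic (A : set T) : measurable A -> spanned (\1_A).
Proof.
have ind1 (U : Type) (C : set U) u : `|\1_C u : R| <= 1.
  by rewrite indicE; case: (_ \in _); rewrite ?normr1 ?normr0.
have dyn := @spanned_dynkin _ _ _ mu2 _ _ _ _ mD mW W0 me iW.
have H1 (c : R) : spanned (fun z => \1_`]c, +oo[ z.2).
  apply: (eq_spanned mD mW W0 me) (spanned_rays (-2) c) => z /squareP[/andP[z1 _] _].
  by rewrite indic_ray_eq1// mulr1.
have H2 (c : R) (A1 : set RT) : measurable A1 ->
    spanned (fun z => \1_`]c, +oo[ z.2 * \1_A1 z.1).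
  apply: (dyn _ RT fst (fun z => \1_`]c, +oo[ z.2) _ measurable_fst2 _
    measurable_rays rays_setI_closed (H1 c)) => //.
  by move=> _ [a ->]; exact: spanned_rays.
have H3 (A1 : set RT) : measurable A1 -> spanned (fun z => \1_A1 z.1).
  move=> mA; apply: (eq_spanned mD mW W0 me) (H2 (-2) _ mA) => z /squareP[_ /andP[z2 _]].
  by rewrite indic_ray_eq1// mul1r.
have H4 (A1 A2 : set RT) : measurable A1 -> measurable A2 ->
    spanned (fun z => \1_A1 z.1 * \1_A2 z.2).
  move=> mA1.
  apply: (dyn _ RT snd (fun z => \1_A1 z.1) _ measurable_snd2 _
    measurable_rays rays_setI_closed (H3 _ mA1)) => //.
  move=> _ [a ->]; apply: (eq_spanned mD mW W0 me) (H2 a _ mA1) => z _.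
  by rewrite mulrC.
have H5 : spanned (fun=> 1).
  by apply: (eq_spanned mD mW W0 me) (H3 _ measurableT) => z _; rewrite indicT.
move=> mA; pose G := [set B `*` C | B in @measurable _ RT & C in @measurable _ RT].
apply: (eq_spanned mD mW W0 me) (dyn _ T id (fun=> 1) G _ _ _ _ H5 _ A mA) => //.
- by move=> z _; rewrite mul1r.
- by rewrite normr1.
- exact: measurable_prod_measurableType.
- move=> _ _ [B1 mB1 [C1 mC1 <-]] [B2 mB2 [C2 mC2 <-]].
  exists (B1 `&` B2); first exact: measurableI.
  by exists (C1 `&` C2); [exact: measurableI|rewrite setXI].
- move=> _ [B mB [C mC <-]]; apply: (eq_spanned mD mW W0 me) (H4 B C mB mC) => z _.
  by rewrite mul1r !indicE -natrM mulnb; congr (_%:R); rewrite in_setX.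
Qed.

Lemma poly_dense (f : R * R -> R) : measurable_fun (square : set T) f ->
  mu2.-integrable square (fun z => (f z ^+ 2 * W z)%:E) -> spanned f.
Proof. exact: (spanned_all mD mW W0 me spanned_indic). Qed.

End SquareDensity.

(** * The orthogonal system *)

(** An index that occurs several times in the list receives the sum of its
    coefficients. *)
Lemma lincomb_collect (R : realType) (U : Type) (I : eqType) (e : I -> U -> R)
    (l : seq (R * I)) :
  exists (s : seq I) (c : I -> R), forall z,
    \sum_(x <- l) x.1 * e x.2 z = \sum_(a <- s) c a * e a z.
Proof.
exists (undup (map snd l)), (fun a => \sum_(x <- l | x.2 == a) x.1) => z.
rewrite [RHS](eq_bigr (fun a => \sum_(x <- l | x.2 == a) x.1 * e x.2 z)); last first.
  by move=> a _; rewrite mulr_suml; apply: eq_bigr => x /eqP ->.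
rewrite (exchange_big_dep predT)//= big_seq [RHS]big_seq; apply: eq_bigr => x xl.
rewrite -big_filter (_ : [seq a <- _ | _] = [:: x.2]) ?big_seq1//.
rewrite (eq_filter (a2 := pred1 x.2)); last by move=> a; rewrite /= eq_sym.
by rewrite filter_pred1_uniq ?undup_uniq// mem_undup map_f.
Qed.

Section System.
Context {R : realType} (w : R -> R) (P : nat -> nat -> {poly R})
  (Y : forall m : nat, 'I_(minn m.+1 4) -> mpoly 2 R).
Local Notation mu := (@lebesgue_measure R).
Local Notation mu2 := (@lebesgue2 R).
Local Notation RT := (measurableTypeR R).
Local Notation T := (RT * RT)%type.
Hypothesis hw : weight_function w.
Hypothesis hP : forall n k m : nat, (k <= n)%N ->
  orthogonal_poly (fun t => t ^+ (2 * n - 2 * k + 1)%N * w t) m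
    (P m (2 * n - 2 * k)%N).
Hypothesis hY : forall m : nat, orthogonal_basis_BV m (@Y m).
Local Notation W := (fun z : R * R => w (maxnorm z)).

(** The members of the system have this form, with j = n - k. *)
Definition polarfun (A : {poly R}) (j : nat) (p : mpoly 2 R) (z : R * R) : R :=
  A.[maxnorm z] * maxnorm z ^+ j * eval2 p (direction z).1 (direction z).2.

Lemma QE a : Q P Y a =
  polarfun (P (tag (tagged a)) (2 * (tag a - tag (tagged a)))) (tag a - tag (tagged a))
    (@Y (tag a - tag (tagged a)) (tagged (tagged a))).
Proof. by apply/funext => z; rewrite /Q /polarfun mulnBr. Qed.

(** The index is (n, k, i) with n = j + k. *)
Lemma Q_onto j k (i : 'I_(minn j.+1 4)) :
  exists a, Q P Y a = polarfun (P k (2 * j)) j (@Y j i).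
Proof.
have [n [kn nk]] : exists n, (k <= n)%N /\ (n - k = j)%N.
  by exists (j + k)%N; rewrite leq_addl addnK.
move: i; rewrite -nk => i.
have kn1 : (k < n.+1)%N by [].
pose a : Qindex := existT (fun n => {k : 'I_n.+1 & 'I_(minn (n - k).+1 4)}) n
  (existT (fun k : 'I_n.+1 => 'I_(minn (n - k).+1 4)) (Ordinal kn1) i).
by exists a; rewrite QE.
Qed.

Lemma Q_neq (a b : Qindex) : a != b ->
  [\/ (tag a - tag (tagged a) != tag b - tag (tagged b))%N,
      tag (tagged a) != tag (tagged b) :> nat |
      (tagged (tagged a) : nat) != tagged (tagged b)].
Proof.
case: a b => [n [k i]] [n' [k' i']] /= ab.
have [nk|] := eqVneq (n - k)%N (n' - k')%N; last by constructor 1.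
have [kk|] := eqVneq (k : nat) k'; last by constructor 2.
have [ii|] := eqVneq (i : nat) i'; last by constructor 3.
exfalso; move/eqP: ab; apply.
have nn : n = n' by have := ltn_ord k; have := ltn_ord k'; lia.
subst n'; have {}kk : k = k' by exact/val_inj.
subst k'; have {}ii : i = i' by exact/val_inj.
by rewrite ii.
Qed.

Lemma radial_orthogonal j m :
  orthogonal_poly (fun t => t ^+ (2 * j).+1 * w t) m (P m (2 * j)).
Proof. by have := hP m (leq0n j); rewrite muln0 subn0 addn1. Qed.

Lemma polarfunM A B j k p q z :
  polarfun A j p z * polarfun B k q z * W z =
  polar w (A * B * 'X^(j + k)) (p * q) z.
Proof.
rewrite /polarfun /polar !hornerM hornerXn exprD eval2M; ring.
Qed.

Lemma inner_polarfun A B j k p q :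
  mu2.-integrable square (fun z => (polarfun A j p z * polarfun B k q z * W z)%:E) /\
  innerW W (polarfun A j p) (polarfun B k q) =
    intpoly `[0, 1] w ('X * (A * B * 'X^(j + k))) * innerB p q.
Proof.
have [i ie] := polar_factorsP hw (A * B * 'X^(j + k)) (p * q).
split.
  by apply: eq_integrable i => // [|z _]; [exact: measurable_square|rewrite polarfunM].
rewrite /innerW innerBE -ie.
by apply: eq_Rintegral => z _; rewrite polarfunM.
Qed.

Lemma measurable_polarfun A j p : measurable_fun (square : set T) (polarfun A j p).
Proof.
have mA : measurable_fun setT (fun t : R => (A * 'X^j).[t]) by exact: measurable_horner.
have := measurable_funTS (D := square) (measurable_polar mA (measurable_eval2 p)).
apply: eq_measurable_fun => z _.
by rewrite /polarfun hornerM hornerXn.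
Qed.

Let wmom j : mu.-integrable `[0 : R, 1] (fun t => (t ^+ j * w t)%:E).
Proof. by have [_ _ + _] := hw; apply. Qed.

Let w0 t : t \in `[0 : R, 1] -> 0 <= w t.
Proof. by have [_ + _ _] := hw; apply. Qed.

(** The exponent of t in the radial weight splits into [j + j] from the two
    functions and 1 from the Jacobian. *)
Lemma radial_gt0 j k :
  0 < intpoly `[0, 1] w ('X * (P k (2 * j) * P k (2 * j) * 'X^(j + j))).
Proof.
have [_ _ _ iw] := hw; have [sP _] := radial_orthogonal j k.
have P0 : P k (2 * j) != 0 by rewrite -size_poly_eq0 sP.
apply: intpoly_gt0 => //.
- by rewrite !mulf_neq0// ?polyX_eq0// expf_neq0// polyX_eq0.
- move=> t; rewrite /= in_itv/= => /andP[t0 _].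
  rewrite !hornerM hornerX hornerXn -expr2 mulr_ge0//.
  by rewrite mulr_ge0 ?sqr_ge0 ?exprn_ge0.
Qed.

Lemma radial_eq0 j k l : (k < l)%N ->
  intpoly `[0, 1] w ('X * (P k (2 * j) * P l (2 * j) * 'X^(j + j))) = 0.
Proof.
move=> kl; have [sP _] := radial_orthogonal j k; have [_ oP] := radial_orthogonal j l.
rewrite -[RHS](oP (P k (2 * j))) ?sP//.
apply: eq_Rintegral => t _; rewrite !hornerM hornerX hornerXn mul2n -addnn exprS.
ring.
Qed.

Lemma L2W_Q a : L2W W (Q P Y a).
Proof.
rewrite QE; split; first exact: measurable_polarfun.
set A := P _ _; set j := (_ - _)%N; set p := Y _.
have [+ _] := inner_polarfun A A j j p p.
by apply: eq_integrable => //; exact: measurable_square.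
Qed.

Lemma normW_Q_gt0 a : 0 < normW W (Q P Y a).
Proof.
rewrite /normW sqrtr_gt0 QE.
have [_ ->] := inner_polarfun (P (tag (tagged a)) (2 * (tag a - tag (tagged a))))
  (P (tag (tagged a)) (2 * (tag a - tag (tagged a)))) (tag a - tag (tagged a))
  (tag a - tag (tagged a)) (@Y (tag a - tag (tagged a)) (tagged (tagged a)))
  (@Y (tag a - tag (tagged a)) (tagged (tagged a))).
by rewrite mulr_gt0 ?radial_gt0// (innerY_gt0 hY).
Qed.

Lemma innerY_eq0 m j (i : 'I_(minn m.+1 4)) (k : 'I_(minn j.+1 4)) :
  (m != j) || (i != k :> nat) ->
  innerB (@Y m i) (@Y j k) = 0.
Proof.
have [mj|mj _] := eqVneq m j; last exact: innerY_neq.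
subst j => /= ik; have [_ _ _] := hY m; apply.
by apply: contra ik => /eqP ->.
Qed.

Lemma innerW_Q_eq0 a b : a != b -> innerW W (Q P Y a) (Q P Y b) = 0.
Proof.
move=> /Q_neq ab; rewrite !QE.
move: ab; case: a b => [n [k i]] [n' [k' i']] /=.
move: (n - k)%N (n' - k')%N i i' => j j' i i' ab.
have [_ ->] := inner_polarfun (P k (2 * j)) (P k' (2 * j')) j j' (Y i) (Y i').
have [jj|] := boolP ((j != j') || ((i : nat) != i')).
  by rewrite innerY_eq0// mulr0.
rewrite negb_or !negbK => /andP[/eqP jj /eqP ii]; subst j'.
case: ab; rewrite ?ii ?eqxx//.
rewrite neq_ltn => /orP[kk|kk]; first by rewrite radial_eq0 ?mul0r.
by rewrite [P k _ * _]mulrC radial_eq0 ?mul0r.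
Qed.

Let mW : measurable_fun (square : set T) W.
Proof.
have [mw _ _ _] := hw.
apply: (measurable_comp (F := (`[0 : R, 1] : set RT))) mw _ => //.
  move=> _ [z /square_maxnorm z1 <-] /=.
  by rewrite in_itv/= maxnorm_ge0.
by apply: measurable_funTS; exact: measurable_maxnorm.
Qed.

Let W0 z : square z -> 0 <= W z.
Proof. by move=> /square_maxnorm z1; rewrite w0// in_itv/= maxnorm_ge0. Qed.

Let iW : mu2.-integrable square (EFin \o W).
Proof.
have [i _] := polar_factorsP hw 1 1; apply: eq_integrable i => // [|z _].
  exact: measurable_square.
by rewrite /polar hornerC /eval2 meval1 !mul1r.
Qed.

Let mQ a : measurable_fun (square : set T) (Q P Y a).
Proof. by rewrite QE; exact: measurable_polarfun. Qed.

Let mD : measurable (square : set T) := @measurable_square R.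

Local Notation spanned := (spanned mu2 square W (Q P Y)).

Let span0 : spanned (fun=> 0).
Proof. exact: spanned0. Qed.

Let eq_span f g : (forall z : R * R, square z -> f z = g z) -> spanned f -> spanned g.
Proof. exact: (eq_spanned mD mW W0 mQ). Qed.

Lemma spanned_radial A j i : spanned (polarfun A j (@Y j i)).
Proof.
move: A; apply: (@poly_span _ _ (fun k => P k (2 * j))).
- apply: eq_span span0 => z _.
  by rewrite /polarfun horner0 !mul0r.
- move=> c A B sA sB; apply: eq_span (spanned_linear mD mW W0 mQ c sA sB) => z _.
  by rewrite /polarfun hornerD hornerZ !mulrDl !mulrA.
- move=> k; split; first by have [] := radial_orthogonal j k.
  by have [a <-] := Q_onto k i; exact: spanned_gen.
Qed.

Lemma direction_onboundary (z : R * R) : z != (0, 0) ->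
  onboundary (direction z).1 (direction z).2.
Proof.
move=> z0; have s0 : 0 < maxnorm z.
  rewrite lt_def maxnorm_ge0 andbT; apply: contra z0; rewrite /maxnorm.
  case: z => x y /=; rewrite eq_le ge_max !normr_le0 => /andP[/andP[/eqP -> /eqP ->] _].
  exact: eqxx.
rewrite /onboundary /direction /= !normrM !normfV (ger0_norm (ltW s0)).
by rewrite -maxr_pMl ?invr_ge0 ?(ltW s0)// divff// gt_eqF.
Qed.

Lemma ae_neq0 : {ae mu2, forall z, z != (0, 0)}.
Proof.
exists ([set 0] `*` setT `|` setT `*` [set 0]); split.
- by apply: measurableU; apply: measurableX.
- exact: lebesgue2_line.
- by move=> z /= /negP; rewrite negbK => /eqP ->; left.
Qed.

(** On the boundary [p] expands into the Y's of degree j <= m, and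
    s^m = s^(m-j) s^j. *)
Lemma spanned_homogeneous m p : (msize p <= m.+1)%N ->
  spanned (fun z => maxnorm z ^+ m * eval2 p (direction z).1 (direction z).2).
Proof.
have mK q : measurable_fun (square : set T)
    (fun z => maxnorm z ^+ m * eval2 q (direction z).1 (direction z).2).
  have := measurable_polarfun 1 m q; apply: eq_measurable_fun => z _.
  by rewrite /polarfun hornerC mul1r.
move: p; apply: (@boundary_span _ _ hY).
- apply: eq_span span0 => z _.
  by rewrite /eval2 meval0 mulr0.
- move=> c p q sp sq; apply: eq_span (spanned_linear mD mW W0 mQ c sp sq) => z _.
  by rewrite eval2D eval2Z; ring.
- move=> p q pq sp; apply: (spanned_ae_eq mD mW W0 mQ sp (mK q)).
  have [N [mN N0 hN]] := ae_neq0; exists N; split => //.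
  apply: subset_trans hN; apply: subsetC => z z0 _.
  by rewrite (pq _ _ (direction_onboundary z0)).
- move=> j i jm; have := spanned_radial ('X^(m - j)) i.
  apply: eq_span => z _.
  by rewrite /polarfun hornerXn -exprD subnK.
Qed.

Lemma eval2_monomial m (s x y : R) :
  eval2 (mpolyX R m) (s * x) (s * y) = s ^+ mdeg m * eval2 (mpolyX R m) x y.
Proof.
rewrite /eval2 !mevalX mdegE -prodrXr -big_split/=.
by apply: eq_bigr => i _; rewrite -exprMn; case: ifP.
Qed.

(** Also true at the origin, where both sides are 0. *)
Lemma maxnorm_direction (z : R * R) :
  z.1 = maxnorm z * (direction z).1 /\ z.2 = maxnorm z * (direction z).2.
Proof.
have [z0|z0] := eqVneq (maxnorm z) 0.
  have : maxnorm z <= 0 by rewrite z0.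
  by rewrite ge_max !normr_le0 z0 !mul0r => /andP[/eqP -> /eqP ->].
by rewrite /direction /= ![maxnorm z * _]mulrC !divfK.
Qed.

Lemma spanned_poly p : spanned (fun z => eval2 p z.1 z.2).
Proof.
elim/mpolyind: p => [|c m p _ _ IH].
  apply: eq_span span0 => z _.
  by rewrite /eval2 meval0.
have sm : spanned (fun z => eval2 (mpolyX R m) z.1 z.2).
  have := @spanned_homogeneous (mdeg m) (mpolyX R m); rewrite msizeX leqnn.
  move=> /(_ isT); apply: eq_span => z _.
  by rewrite -eval2_monomial; have [<- <-] := maxnorm_direction z.
apply: eq_span (spanned_linear mD mW W0 mQ c sm IH) => z _.
by rewrite eval2D eval2Z.
Qed.

Lemma L2W_spanned f : L2W W f -> spanned f.
Proof. by move=> [mf fi]; exact: (poly_dense mW W0 mQ iW spanned_poly mf fi). Qed.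

Lemma Q_dense f : L2W W f -> forall eps : R, 0 < eps ->
  exists (s : seq Qindex) (c : Qindex -> R),
    normW W (fun z => f z - \sum_(a <- s) c a * Q P Y a z) < eps.
Proof.
move=> /L2W_spanned[mf sf] eps eps0.
have [|l fl] := sf (eps ^+ 2 / 2); first by rewrite divr_gt0 ?exprn_gt0.
have [s [c lE]] := lincomb_collect (Q P Y) l; exists s, c.
pose h (z : R * R) := f z - \sum_(a <- s) c a * Q P Y a z.
have hE : innerW W h h = fine (sqnorm mu2 square W (fun z => f z - lincomb (Q P Y) l z)).
  congr fine; apply: eq_integral => z _.
  have -> : h z = f z - lincomb (Q P Y) l z by rewrite /lincomb lE.
  by rewrite expr2.
have n0 : (0 <= sqnorm mu2 square W (fun z => (f z - lincomb (Q P Y) l z)%R))%E.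
  by apply: integral_ge0 => z sz; rewrite lee_fin mulr_ge0 ?sqr_ge0 ?W0.
have i0 : 0 <= innerW W h h by rewrite hE fine_ge0.
change (normW W h < eps).
rewrite -(ltr_pXn2r (n := 2)) ?nnegrE ?sqrtr_ge0 ?(ltW eps0)//.
rewrite sqr_sqrtr//.
apply: (@le_lt_trans _ _ (eps ^+ 2 / 2)); last first.
  by rewrite ltr_pdivrMr// ltr_pMr ?exprn_gt0// ltr1n.
rewrite hE -lee_fin fineK// ge0_fin_numE//.
exact: le_lt_trans fl (ltry _).
Qed.

End System.

Theorem theorem4p1 (R : realType) (w : R -> R)
    (P : nat -> nat -> {poly R})
    (Y : forall m : nat, 'I_(minn m.+1 4) -> mpoly 2 R)
    (hw : weight_function w)
    (hP : forall n k m : nat, (k <= n)%N ->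
      orthogonal_poly (fun t => t ^+ (2 * n - 2 * k + 1)%N * w t) m
        (P m (2 * n - 2 * k)%N))
    (hP0 : forall n k : nat, (k <= n)%N -> P 0%N (2 * n - 2 * k)%N = 1)
    (hY : forall m : nat, orthogonal_basis_BV m (@Y m)) :
  complete_orthogonal_basis (fun z : R * R => w (maxnorm z)) (Q P Y).
Proof.
split.
- by move=> a; split; [exact: L2W_Q|exact: normW_Q_gt0].
- by move=> a b; exact: innerW_Q_eq0.
- exact: Q_dense.
Qed.
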